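(* Let $\lambda>-1$ and $t\in\mathbb{R}$. The monic polynomials $P_n(x)$ orthogonal with respect to the generalised sextic Freud weight $\omega(x;t,\lambda)=|x|^{2\lambda+1}\exp(-x^6+tx^2)$ on $\mathbb{R}$ satisfy the recurrence relation $$P_{n+1}(x)=xP_n(x)-\beta_n(t;\lambda)P_{n-1}(x),\qquad n=0,1,2,\ldots,$$ with $P_{-1}(x)=0$ and $P_0(x)=1$, where, for $n\ge 0$, \begin{align*} \beta_{2n}(t;\lambda)&=\frac{\mathcal{A}_{n+1}(t;\lambda)\,\mathcal{A}_{n-1}(t;\lambda+1)}{\mathcal{A}_n(t;\lambda)\,\mathcal{A}_n(t;\lambda+1)}=\frac{d}{dt}\ln\frac{\mathcal{A}_n(t;\lambda+1)}{\mathcal{A}_n(t;\lambda)},\\ \beta_{2n+1}(t;\lambda)&=\frac{\mathcal{A}_n(t;\lambda)\,\mathcal{A}_{n+1}(t;\lambda+1)}{\mathcal{A}_{n+1}(t;\lambda)\,\mathcal{A}_n(t;\lambda+1)}=\frac{d}{dt}\ln\frac{\mathcal{A}_{n+1}(t;\lambda)}{\mathcal{A}_n(t;\lambda+1)}. \end{align*} Here $\mathcal{A}_n(t;\lambda)$ is the Wronskian (in the variable $t$) $$\mathcal{A}_n(t;\lambda)=\mathcal{W}\left(\mu_0,\frac{d\mu_0}{dt},\ldots,\frac{d^{n-1}\mu_0}{dt^{n-1}}\right),$$ with \begin{align*} \mu_0(t;\lambda)&=\int_{-\infty}^{\infty}|x|^{2\lambda+1}\exp(-x^6+tx^2)\,dx\\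 &=\tfrac13\Gamma(\tfrac13\lambda+\tfrac13)\;{}_1F_2\left(\tfrac13\lambda+\tfrac13;\tfrac13,\tfrac23;(\tfrac13t)^3\right)+\tfrac13\,t\,\Gamma(\tfrac13\lambda+\tfrac23)\;{}_1F_2\left(\tfrac13\lambda+\tfrac23;\tfrac23,\tfrac43;(\tfrac13t)^3\right)\\ &\qquad+\tfrac16\,t^2\,\Gamma(\tfrac13\lambda+1)\;{}_1F_2\left(\tfrac13\lambda+1;\tfrac43,\tfrac53;(\tfrac13t)^3\right). \end{align*}
   Context: ${}_1F_2(a_1;b_1,b_2;z)=\sum_{k=0}^\infty\frac{(a_1)_k}{(b_1)_k(b_2)_k}\frac{z^k}{k!}$ is the generalised hypergeometric function. For functions $\varphi_1,\ldots,\varphi_n$ of $t$, $\mathcal{W}(\varphi_1,\ldots,\varphi_n)=\det\left[\frac{d^{j-1}\varphi_k}{dt^{j-1}}\right]_{j,k=1}^n$. Conventions: $\mathcal{A}_0=1$, $\mathcal{A}_{-1}=0$, so that $\beta_0=0$. *)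

(* Defs.v *)
From HB Require Import structures.
From mathcomp Require Import all_boot all_order all_algebra.
From mathcomp Require Import all_classical all_reals all_analysis.

Set Implicit Arguments.
Unset Strict Implicit.
Unset Printing Implicit Defensive.

Import Order.TTheory GRing.Theory Num.Theory.
Import numFieldNormedType.Exports.

Local Open Scope classical_set_scope.
Local Open Scope ring_scope.

(* Euler's integral; meaningful for 0 < s. *)
Definition Gamma (R : realType) (s : R) : R :=
  \int[lebesgue_measure]_(x in `]0, +oo[) (x `^ (s - 1) * expR (- x)).

Definition pochhammer (R : realType) (a : R) (k : nat) : R :=
  \prod_(0 <= i < k) (a + i%:R).

(* The series converges for every z when b1 and b2 are not nonpositive
   integers. *)
Definition hyp1F2 (R : realType) (a1 b1 b2 z : R) : R :=
  limn (series (fun k : nat =>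
    pochhammer a1 k / (pochhammer b1 k * pochhammer b2 k)
      * (z ^+ k / k`!%:R))).

(* If 2 * lam + 1 < 0 the weight is singular at x = 0, where powR returns the
   conventional value 0. *)
Definition freud_weight (R : realType) (lam t x : R) : R :=
  `|x| `^ (2 * lam + 1) * expR (- x ^+ 6 + t * x ^+ 2).

Definition mu0 (R : realType) (lam t : R) : R :=
  \int[lebesgue_measure]_x freud_weight lam t x.

Definition wronskian (R : realType) (n : nat) (phi : 'I_n -> R -> R) (t : R)
    : R :=
  \det (\matrix_(j < n, k < n) derive1n j (phi k) t).

(* The index is an integer so that the value 0 at n = -1 can be stated;
   the value 1 at n = 0 is the determinant of the empty matrix. *)
Definition freudA (R : realType) (n : int) (lam t : R) : R :=
  match n with
  | Posz m => wronskian (fun k : 'I_m => derive1n k (mu0 lam)) t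
  | Negz _ => 0
  end.

(* The squared norms need not be required to be positive: the weight is
   positive almost everywhere. An integral of an extended-real valued function
   can only be 0 if its positive and negative parts have finite integrals. *)
Definition monic_orthogonal (R : realType) (w : R -> R) (P : nat -> {poly R})
    : Prop :=
  (forall n, P n \is monic /\ size (P n) = n.+1) /\
  (forall m n, m <> n ->
    (\int[lebesgue_measure]_x ((P m).[x] * (P n).[x] * w x)%:E = 0)%E).

(* Main.v *)
Require Import Defs.
From HB Require Import structures.
From mathcomp Require Import all_boot all_order all_algebra.
From mathcomp Require Import all_classical all_reals all_analysis.
From mathcomp Require Import measurable_realfun.
From mathcomp Require Import zify ring lra.
Import Order.TTheory GRing.Theory Num.Theory.
Import numFieldNormedType.Exports.
Local Open Scope classical_set_scope.
Local Open Scope ring_scope.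

(* Let h_n be the squared norm of the n-th monic orthogonal polynomial P_n and
   b_n = h_n / h_(n-1). The weight is even, so P_(n+1) = X P_n - b_n P_(n-1) and
   P_n has the parity of n. Hence the change of basis from the monomials
   X^(2j+e), j < n, to the polynomials P_(2j+e) is unitriangular, and the
   Hankel determinant A_n(t; lam + e) is the product of the h_(2k+e), k < n.
   Since d/dt of the weight is x^2 times the weight and dP_n/dt has degree
   below n, h_n' = int x^2 P_n^2 w = (b_n + b_(n+1)) h_n, so the logarithmic
   derivatives of the quotients of Hankel determinants telescope to b_n.
   For the closed form of the moment, exp(t x^2) is expanded under the integral;
   the substitution u = x^6 turns the coefficients into values of Gamma, and
   splitting the series modulo 3 gives the three hypergeometric functions. *)

Set Implicit Arguments.
Unset Strict Implicit.
Unset Printing Implicit Defensive.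

(** * Orthogonal polynomials of an even positive functional *)

(** Differentiability in t is circular at first sight: the coefficients of P_(n+1) contain b_n = h_n
    / h_(n-1), while the formula for h_n' presupposes that the coefficients of P_n can be
    differentiated. One induction on the degree settles both. It is carried out for an abstract
    moment sequence with three properties: the derivative of the i-th moment is the (i+2)-nd, odd
    moments vanish, and the square of a nonzero polynomial has a positive value. Analysis is then
    needed only to establish these for the Freud weight. The first rests on the identity that x^2
    times the weight with parameter lam is the weight with parameter lam + 1, which also makes every
    entry of the Wronskian an even moment and explains why lam + 1 selects the odd polynomials. In
    the closed form the substitution is used at t = 0 only. Steps of 3 in lam are governed by a
    recurrence from integration by parts, the functional equation of Gamma in disguise, and its
    iteration produces the Pochhammer symbols. *)

Section OrthogonalPolynomials.
Variables (F : realFieldType) (L : {scalar {poly F}}).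

(* The pair (P_n, P_(n-1)) with P_(-1) = 0. At n = 0 the coefficient is a
   division by L 0 = 0, but it multiplies P_(-1) = 0. *)
Fixpoint stieltjes (n : nat) : {poly F} * {poly F} :=
  if n is m.+1 then
    let: (p, q) := stieltjes m in
    ('X * p - (L (p * p) / L (q * q)) *: q, p)
  else (1, 0).

Definition orthp (n : nat) : {poly F} := (stieltjes n).1.

Definition orthn (n : nat) : F := L (orthp n * orthp n).

Definition orthb (n : nat) : F :=
  if n is m.+1 then orthn n / orthn m else 0.

Lemma orthpS n : orthp n.+1 =
  'X * orthp n - orthb n *: (if n is m.+1 then orthp m else 0).
Proof.
have E : stieltjes n = (orthp n, if n is m.+1 then orthp m else 0).
  by case: n => //= n; rewrite /orthp /=; case: (stieltjes n).
rewrite {1}/orthp /= E; congr (_ - _); rewrite -/(orthn n).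
by case: n {E} => [|n]; rewrite ?scaler0.
Qed.

Lemma orthp_monic_size n : orthp n \is monic /\ size (orthp n) = n.+1.
Proof.
elim/ltn_ind: n => -[|n] IH; first by rewrite /orthp /= monic1 size_poly1.
have [mn sn] := IH n (ltnSn n).
have sX : size ('X * orthp n) = n.+2.
  by rewrite mulrC size_mulX ?sn// -size_poly_eq0 sn.
have sq : (size (- (orthb n *: (if n is m.+1 then orthp m else 0%R)))
    < size ('X * orthp n)%R)%N.
  rewrite size_polyN sX; apply: leq_ltn_trans (size_scale_leq _ _) _.
  by case: n IH {mn sn sX} => [|m] IH; rewrite ?size_poly0// (IH m _).2.
rewrite orthpS size_polyDl// sX; split=> //.
by rewrite monicE lead_coefDl// lead_coefM lead_coefX mul1r -monicE.
Qed.

Hypothesis L_odd : forall i, odd i -> L 'X^i = 0.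

Lemma orthp_parity n : orthp n \Po (- 'X) = (-1) ^+ n *: orthp n.
Proof.
elim/ltn_ind: n => -[|n] IH.
  by rewrite /orthp /= comp_polyC scale1r.
rewrite orthpS comp_polyB comp_polyM comp_polyX comp_polyZ IH//.
have -> : (if n is m.+1 then orthp m else 0) \Po - 'X =
    (-1) ^+ n.+1 *: (if n is m.+1 then orthp m else 0).
  case: n IH => [|m] IH; first by rewrite comp_poly0 scaler0.
  by rewrite IH// !exprS !mulN1r opprK.
rewrite scalerBr !scalerA [_ * orthb n]mulrC; congr (_ - _).
by rewrite mulNr -scalerAr exprS mulN1r scaleNr.
Qed.

Lemma even_functional_comp p : L (p \Po (- 'X)) = L p.
Proof.
have E : p = \sum_(i < size p) p`_i *: 'X^i by rewrite -poly_def coefK.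
rewrite E raddf_sum /= 2!raddf_sum /=; apply: eq_bigr => i _.
rewrite comp_polyZ !linearZ /=; congr (_ * _).
rewrite comp_Xn_poly exprNn -signr_odd; have [/L_odd Li|_] := boolP (odd i).
  by rewrite mulN1r linearN /= Li oppr0.
by rewrite mul1r.
Qed.

(** X P_n^2 is an odd polynomial, so reflection turns its value into its negative. This is why the
    three-term recurrence has no diagonal coefficient. *)
Lemma orthp_mulX n : L ('X * orthp n * orthp n) = 0.
Proof.
have := even_functional_comp ('X * orthp n * orthp n).
rewrite !comp_polyM comp_polyX orthp_parity -!scalerAr -scalerAl scalerA.
rewrite -expr2 sqrr_sign scale1r mulNr mulNr linearN /= => /eqP.
by rewrite eq_sym -addr_eq0 -mulr2n mulrn_eq0 => /eqP.
Qed.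

Hypothesis L_pos : forall p : {poly F}, p != 0 -> 0 < L (p * p).

Lemma orthn_gt0 n : 0 < orthn n.
Proof. by apply: L_pos; rewrite -size_poly_eq0 (orthp_monic_size n).2. Qed.

Lemma orthb_mul n : orthb n.+1 * orthn n = orthn n.+1.
Proof. by rewrite /orthb divfK// gt_eqF// orthn_gt0. Qed.

(** In L(P_m P_(n+1)) the factor X is moved from P_n to P_m and X P_m is expanded again. For m = n
    parity decides, for m = n - 1 the choice of b_n, and below that every term vanishes by
    induction. *)
Lemma orthp_ortho m n : (m < n)%N -> L (orthp m * orthp n) = 0.
Proof.
elim/ltn_ind: n m => -[//|n] IH m; rewrite ltnS => mn.
have XE k : 'X * orthp k = orthp k.+1 +
    orthb k *: (if k is j.+1 then orthp j else 0) by rewrite orthpS subrK.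
have sc (a : F) (p q : {poly F}) : L (p * (a *: q)) = a * L (p * q).
  by rewrite -scalerAr linearZ.
rewrite orthpS mulrBr linearB /= sc.
move: mn; rewrite leq_eqVlt => /predU1P[->|mn].
  rewrite mulrCA mulrA orthp_mulX sub0r.
  case: n IH => [|n] IH; first by rewrite mul0r oppr0.
  by rewrite [orthp n.+1 * _]mulrC IH// mulr0 oppr0.
rewrite mulrCA mulrA XE mulrDl linearD /= -scalerAl linearZ /=.
have -> : L ((if m is j.+1 then orthp j else 0) * orthp n) = 0.
  by case: m mn => [|m] mn; rewrite ?mul0r ?linear0// IH// ltnW.
case: n mn IH {XE} => // n; rewrite ltnS leq_eqVlt => /predU1P[->|mn] IH.
  by rewrite mulr0 addr0 orthb_mul /orthn subrr.
by rewrite mulr0 addr0 !IH// mulr0 subr0.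
Qed.

(** Subtracting from q its leading coefficient times the member of the same degree lowers the
    degree. The family is arbitrary because uniqueness needs this for [orthp] and for its
    competitor. *)
Lemma monic_family_ortho_lower (P : nat -> {poly F}) :
    (forall n, P n \is monic /\ size (P n) = n.+1) ->
    (forall m n, m <> n -> L (P m * P n) = 0) ->
  forall n (q : {poly F}), (size q <= n)%N -> L (q * P n) = 0.
Proof.
move=> Pm PL n q; have [k] := ubnP (size q).
elim: k q => // k IH q; rewrite ltnS => qk qn.
have [->|q0] := eqVneq q 0; first by rewrite mul0r linear0.
have sq : (0 < size q)%N by rewrite size_poly_gt0.
have [mP sP] := Pm (size q).-1; rewrite prednK// in sP.
have lP := monicP mP; rewrite {1}/lead_coef sP in lP.
have sr : (size (q - lead_coef q *: P (size q).-1)%R < size q)%N.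
  rewrite -[ltnRHS](prednK sq) ltnS; apply/leq_sizeP => i.
  rewrite leq_eqVlt => /predU1P[<-|li].
    by rewrite coefB coefZ lP mulr1 subrr.
  by rewrite coefB coefZ !nth_default ?sP ?mulr0 ?subr0//; rewrite -(prednK sq).
rewrite -(subrK (lead_coef q *: P (size q).-1) q) mulrDl linearD /=.
rewrite IH ?add0r; [|exact: leq_trans qk|exact: leq_trans (ltnW sr) qn].
rewrite -scalerAl linearZ /= PL ?mulr0//.
by move=> E; move: qn; rewrite -E -{1}(prednK sq) ltnn.
Qed.

Lemma orthp_ortho_neq m n : m <> n -> L (orthp m * orthp n) = 0.
Proof.
move=> /eqP; rewrite neq_ltn => /orP[|] mn; first exact: orthp_ortho.
by rewrite mulrC orthp_ortho.
Qed.

Lemma orthp_ortho_lower n (q : {poly F}) : (size q <= n)%N -> L (q * orthp n) = 0.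
Proof. exact: (monic_family_ortho_lower orthp_monic_size orthp_ortho_neq). Qed.

(** The difference of two monic candidates of degree n has lower degree, so it is orthogonal to both
    and hence to itself; positivity forces it to be 0. *)
Lemma monic_orthogonal_unique (P : nat -> {poly F}) :
    (forall n, P n \is monic /\ size (P n) = n.+1) ->
    (forall m n, m <> n -> L (P m * P n) = 0) ->
  P =1 orthp.
Proof.
move=> Pm PL n; apply/eqP; rewrite -subr_eq0; apply/negPn/negP => /L_pos.
have sd : (size (P n - orthp n)%R <= n)%N.
  have [mP sP] := Pm n; have [mQ sQ] := orthp_monic_size n.
  apply/leq_sizeP => i; rewrite leq_eqVlt => /predU1P[<-|li].
    have := monicP mP; have := monicP mQ; rewrite /lead_coef sP sQ /=.
    by rewrite coefB => -> ->; rewrite subrr.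
  by rewrite coefB !nth_default ?sP ?sQ ?subr0.
rewrite mulrBr linearB /= orthp_ortho_lower//.
by rewrite (monic_family_ortho_lower Pm PL)// subrr ltxx.
Qed.

(** Squaring X P_n = P_(n+1) + b_n P_(n-1) leaves h_(n+1) + b_n^2 h_(n-1) by orthogonality, and b_n
    h_(n-1) = h_n. *)
Lemma orthn_mulX n :
  L ('X^2 * (orthp n * orthp n)) = (orthb n + orthb n.+1) * orthn n.
Proof.
have XE : 'X * orthp n = orthp n.+1 +
    orthb n *: (if n is j.+1 then orthp j else 0) by rewrite orthpS subrK.
have -> : 'X^2 * (orthp n * orthp n) = ('X * orthp n) * ('X * orthp n).
  by rewrite expr2; ring.
rewrite XE mulrDl !mulrDr !linearD /= -!scalerAr -!scalerAl !linearZ /=.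
case: n {XE} => [|n].
  by rewrite /= !mulr0 !mul0r -/(orthn 1) !addr0 add0r orthb_mul.
have neq2 : n.+2 <> n by lia.
rewrite [orthp n * orthp n.+2]mulrC (orthp_ortho_neq neq2).
rewrite !mulr0 addr0 add0r -/(orthn n.+2) -/(orthn n) mulrDl orthb_mul.
by rewrite -/(orthb n.+2) orthb_mul addrC.
Qed.

Lemma orthp_coef_parity n i : odd i != odd n -> (orthp n)`_i = 0.
Proof.
move=> ni; have := congr1 (fun p : {poly F} => p`_i) (orthp_parity n).
have -> : (orthp n \Po - 'X)`_i = (-1) ^+ i * (orthp n)`_i.
  rewrite -scaleN1r comp_polyE coef_sum.
  under eq_bigr do rewrite coefZ exprZn coefZ coefXn.
  have [ilt|ige] := ltnP i (size (orthp n)).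
    rewrite (bigD1 (Ordinal ilt))//= eqxx mulr1 big1 ?addr0 1?mulrC// => j.
    by rewrite -val_eqE /= eq_sym => /negPf ->; rewrite !mulr0.
  rewrite nth_default// mulr0 big1// => j _.
  by rewrite gtn_eqF ?mulr0// (leq_trans _ ige).
rewrite coefZ -(signr_odd _ i) -(signr_odd _ n).
have cN (c : F) : c = - c -> c = 0.
  by move=> /eqP; rewrite -addr_eq0 -mulr2n mulrn_eq0 => /eqP.
case: (odd i) ni; case: (odd n) => // _.
  by rewrite expr1 expr0 mulN1r mul1r => /esym /cN.
by rewrite expr1 expr0 mulN1r mul1r => /cN.
Qed.

Lemma sum_ord_double (V : zmodType) (G : nat -> V) n :
  \sum_(i < n.*2) G i = \sum_(k < n) (G k.*2 + G k.*2.+1).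
Proof.
by elim: n => [|n IH]; rewrite ?big_ord0// doubleS !big_ord_recr /= IH addrA.
Qed.

(** The range [n] does not depend on [j], so that all rows of the change of basis in [gram_det] have
    the same length. *)
Lemma orthp_expand (e : bool) n j : (j < n)%N ->
  orthp (e + j.*2) =
  \sum_(k < n) (orthp (e + j.*2))`_(e + k.*2) *: 'X^(e + k.*2).
Proof.
move=> jn; set p := orthp _.
have pE : p = \sum_(i < n.*2) p`_i *: 'X^i.
  rewrite -poly_def; apply/polyP => i; rewrite coef_poly.
  case: ifPn => // /negP ni; rewrite nth_default// (orthp_monic_size _).2.
  by case: e {p} => /=; lia.
rewrite {1}pE (@sum_ord_double _ (fun i => p`_i *: 'X^i)); apply: eq_bigr => k _.
rewrite /p; case: e {p pE} => /=.
  rewrite (@orthp_coef_parity _ k.*2) ?scale0r ?add0r//.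
  by rewrite /= !odd_double.
rewrite (@orthp_coef_parity _ k.*2.+1) ?scale0r ?addr0//.
by rewrite /= !odd_double.
Qed.

Lemma gram_det (e : bool) n :
  \det (\matrix_(j < n, k < n) L ('X^(e + j.*2) * 'X^(e + k.*2))) =
  \prod_(k < n) orthn (e + k.*2).
Proof.
set H := \matrix_(_, _) _.
pose U := \matrix_(j < n, k < n) (orthp (e + j.*2))`_(e + k.*2).
(* Entry (i, l) of this congruence is L(P_(e+2i) P_(e+2l)). *)
have UHU : U *m H *m U^T = diag_mx (\row_k orthn (e + k.*2)).
  apply/matrixP => i l; rewrite !mxE.
  have -> : \sum_j (U *m H) i j * U^T j l =
      L (orthp (e + i.*2) * orthp (e + l.*2)).
    rewrite [X in L (_ * X)](@orthp_expand e n l)// mulr_sumr linear_sum /=.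
    apply: eq_bigr => k _; rewrite !mxE -scalerAr linearZ /= mulrC; congr (_ * _).
    rewrite [in RHS](@orthp_expand e n i)// mulr_suml linear_sum /=.
    by apply: eq_bigr => m _; rewrite !mxE -scalerAl linearZ.
  have [->|il] := eqVneq i l; first by rewrite mulr1n.
  rewrite mulr0n orthp_ortho_neq//; move/eqP: il => il.
  by move=> E; apply: il; apply/val_inj => /=; lia.
have detU : \det U = 1.
  rewrite det_trig; last first.
    apply/is_trig_mxP => i j ij; rewrite mxE nth_default//.
    by rewrite (orthp_monic_size _).2; lia.
  apply: big1 => i _; rewrite mxE; have [/monicP + s] := orthp_monic_size (e + i.*2).
  by rewrite /lead_coef s.
have := congr1 determinant UHU; rewrite !det_mulmx det_tr detU mul1r mulr1 => ->.
by rewrite det_diag; apply: eq_bigr => i _; rewrite mxE.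
Qed.

End OrthogonalPolynomials.

(** * Linear functionals given by a sequence of moments *)

Section MomentFunctional.
Variables (F : realFieldType) (M : nat -> F).

Definition momf (p : {poly F}) : F := \sum_(i < size p) p`_i * M i.

Lemma momf_widen (N : nat) (p : {poly F}) : (size p <= N)%N ->
  momf p = \sum_(i < N) p`_i * M i.
Proof.
move=> pN; rewrite /momf (big_ord_widen N (fun i => p`_i * M i) pN).
rewrite big_mkcond /=; apply: eq_bigr => i _.
by case: ltnP => // ?; rewrite nth_default ?mul0r.
Qed.

Lemma momf_is_linear : linear_for *%R momf.
Proof.
move=> a p q; pose N := maxn (size p) (size q).
have pN : (size p <= N)%N by rewrite leq_maxl.
have qN : (size q <= N)%N by rewrite leq_maxr.
rewrite !(@momf_widen N)//; last first.
  apply: leq_trans (size_polyD _ _) _; rewrite geq_max qN andbT.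
  exact: leq_trans (size_scale_leq _ _) pN.
rewrite mulr_sumr -big_split /=; apply: eq_bigr => i _.
by rewrite coefD coefZ mulrDl mulrA.
Qed.

HB.instance Definition _ :=
  GRing.isLinear.Build F {poly F} F *%R momf momf_is_linear.

Lemma momfXn i : momf 'X^i = M i.
Proof.
rewrite /momf size_polyXn big_ord_recr /= coefXn eqxx mul1r big1 ?add0r// => j _.
by rewrite coefXn ltn_eqF// mul0r.
Qed.

(** The bounds are fixed in advance, so when the polynomials depend on a parameter the double sum
    keeps its shape and can be differentiated term by term. *)
Lemma momf_mul m n (p q : {poly F}) : (size p <= m)%N -> (size q <= n)%N ->
  momf (p * q) = \sum_(i < m) \sum_(j < n) p`_i * q`_j * M (i + j).
Proof.
have E N (r : {poly F}) : (size r <= N)%N -> r = \sum_(i < N) r`_i *: 'X^i.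
  move=> rN; rewrite -poly_def; apply/polyP => i; rewrite coef_poly.
  by case: ltnP => // ?; rewrite nth_default// (leq_trans rN).
move=> pm qn; rewrite (E m p pm) (E n q qn) mulr_suml linear_sum /=.
apply: eq_bigr => i _; rewrite mulr_sumr linear_sum /=; apply: eq_bigr => j _.
rewrite -(E m p pm) -(E n q qn).
by rewrite -scalerAl -scalerAr !linearZ /= -exprD momfXn mulrA.
Qed.

End MomentFunctional.

(** * Logarithmic derivatives of Hankel determinants *)

Lemma is_derive_sum_fun (R : realType) (n : nat) (f : 'I_n -> R -> R)
    (df : 'I_n -> R) (t : R) :
  (forall i, is_derive t 1 (f i) (df i)) ->
  is_derive t 1 (fun s => \sum_(i < n) f i s) (\sum_(i < n) df i).
Proof. by move=> H; rewrite -fct_sumE; exact: is_derive_sum. Qed.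

Lemma is_derive_ln_comp (R : realType) (f : R -> R) (t df : R) :
  0 < f t -> is_derive t 1 f df -> is_derive t 1 (fun s => ln (f s)) (df / f t).
Proof.
move=> f0 dff; have := is_derive1_comp (is_derive1_ln f0) dff.
by rewrite mulrC => dln; refine dln.
Qed.

Lemma is_derive_mul (R : realType) (f g : R -> R) (t df dg : R) :
  is_derive t 1 f df -> is_derive t 1 g dg ->
  is_derive t 1 (fun s => f s * g s) (f t * dg + g t * df).
Proof. by move=> dff dgg; have H := is_deriveM dff dgg; refine H. Qed.

Lemma derivable_mul (R : realType) (f g : R -> R) (t : R) :
  derivable f t 1 -> derivable g t 1 -> derivable (fun s => f s * g s) t 1.
Proof. by move=> df dg; have H := derivableM df dg; refine H. Qed.

Lemma derivable_inv (R : realType) (f : R -> R) (t : R) :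
  f t != 0 -> derivable f t 1 -> derivable (fun s => (f s)^-1) t 1.
Proof. by move=> f0 df; have H := derivableV f0 df; refine H. Qed.

Section TodaFlow.
Variables (R : realType) (M : R -> nat -> R).
Hypothesis M_derive : forall (t : R) i, is_derive t 1 (fun s => M s i) (M t i.+2).
Hypothesis M_odd : forall t i, odd i -> M t i = 0.
Hypothesis M_pos : forall t (p : {poly R}), p != 0 -> 0 < momf (M t) (p * p).

Let L t : {scalar {poly R}} := momf (M t).

Let L_odd t i : odd i -> L t 'X^i = 0.
Proof. by move=> oi; rewrite /L /= momfXn M_odd. Qed.

Let h n t := orthn (L t) n.
Let b n t := orthb (L t) n.

Let h_gt0 n t : 0 < h n t.
Proof. exact: orthn_gt0 (M_pos t) n. Qed.

(** Differentiability of the coefficients is assumed here and proved in [derivable_coef], whose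
    induction in turn uses this lemma in lower degree. *)
Let is_derive_h_of_coef n (t : R) :
  (forall i, derivable (fun s => (orthp (L s) n)`_i) t 1) ->
  is_derive t 1 (h n) ((b n t + b n.+1 t) * h n t).
Proof.
move=> dP; set P := fun s => orthp (L s) n.
have sP s : (size (P s) <= n.+1)%N by rewrite (orthp_monic_size _ _).2.
have hE : h n = fun s => \sum_(i < n.+1) \sum_(j < n.+1)
    (P s)`_i * (P s)`_j * M s (i + j).
  by apply/funext => s; rewrite -momf_mul.
rewrite {1}hE.
pose D (i : nat) : R := 'D_1 (fun s => (P s)`_i) t.
have dPi i : is_derive t 1 (fun s => (P s)`_i) (D i) by apply: DeriveDef.
(* The leading coefficient is constantly 1, so the derivative Q of P_n has degree below n and is
   orthogonal to P_n. *)
have Dn : D n = 0.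
  rewrite /D (_ : (fun s => _) = cst 1) ?derive_cst//; apply/funext => s /=.
  by have [/monicP + s1] := orthp_monic_size (L s) n; rewrite /lead_coef s1.
pose Q := \poly_(i < n) D i.
have QE i : (i < n.+1)%N -> Q`_i = D i.
  rewrite ltnS leq_eqVlt coef_poly => /predU1P[->|->//]; by rewrite ltnn Dn.
have sQ : (size Q <= n)%N by exact: size_poly.
have LQ : \sum_(i < n.+1) \sum_(j < n.+1) Q`_i * (P t)`_j * M t (i + j) = 0.
  rewrite -momf_mul//; last exact: leq_trans sQ _.
  exact: (@orthp_ortho_lower _ (L t) (L_odd t) (M_pos t) n Q).
(* Shifting the moments by two amounts to multiplying by X^2 under the functional. *)
have LX : \sum_(i < n.+1) \sum_(j < n.+1) (P t)`_i * (P t)`_j * M t (i + j).+2 =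
    L t ('X^2 * (P t * P t)).
  have -> : L t ('X^2 * (P t * P t)) = momf (fun i => M t i.+2) (P t * P t).
    rewrite /L /=.
    rewrite [X in momf (M t) (_ * X)](_ : _ = \sum_(i < size (P t * P t)%R)
      (P t * P t)`_i *: 'X^i); last by rewrite -poly_def coefK.
    rewrite mulr_sumr linear_sum /=; apply: eq_bigr => i _.
    by rewrite -scalerAr linearZ /= -exprD momfXn.
  by rewrite (@momf_mul _ _ n.+1 n.+1).
have H i j := is_derive_mul (is_derive_mul (dPi i) (dPi j)) (M_derive t (i + j)).
apply: is_derive_eq.
  exact: (is_derive_sum_fun (fun i : 'I_n.+1 =>
    is_derive_sum_fun (fun j : 'I_n.+1 => H i j))).
(* The product rule yields three double sums; the last two are L(Q P_n) up to exchanging i and j,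
   hence 0. *)
transitivity (\sum_(i < n.+1) \sum_(j < n.+1)
    ((P t)`_i * (P t)`_j * M t (i + j).+2 + (Q`_i * (P t)`_j * M t (i + j) +
     Q`_j * (P t)`_i * M t (j + i)))).
  apply: eq_bigr => i _; apply: eq_bigr => j _; rewrite !QE// [(j + i)%N]addnC.
  ring.
under eq_bigr do rewrite big_split /= big_split /=.
rewrite big_split /= big_split /= LQ add0r LX [X in _ + X]exchange_big /=.
by rewrite LQ addr0; exact: (orthn_mulX (L_odd t) (M_pos t)).
Qed.

(** The recurrence writes the coefficients of P_(n+1) through those of P_n and P_(n-1) and through
    b_n, a quotient of norms that are differentiable by the induction hypothesis. *)
Let derivable_coef n (t : R) i : derivable (fun s => (orthp (L s) n)`_i) t 1.
Proof.
elim/ltn_ind: n i => -[|n] IH i.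
  have E : (fun s => (orthp (L s) 0)`_i) = cst (1 : {poly R})`_i by [].
  by rewrite E; exact: derivable_cst.
have dh m : (m <= n)%N -> derivable (h m) t 1.
  by move=> mn; apply: ex_derive; apply: is_derive_h_of_coef => j; apply: IH.
have -> : (fun s => (orthp (L s) n.+1)`_i) =
    (fun s => if i is j.+1 then (orthp (L s) n)`_j else 0) -
    (fun s => b n s * (if n is m.+1 then orthp (L s) m else (0 : {poly R}))`_i).
  apply/funext => s; rewrite orthpS coefB coefXM coefZ.
  by case: i => [|i]; case: n {IH dh}.
apply: derivableB; first by case: i => [|i]; [exact: derivable_cst|exact: IH].
case: n IH dh => [|n] IH dh.
  rewrite (_ : (fun s => _) = cst 0); first exact: derivable_cst.
  by apply/funext => s; rewrite mul0r.
apply: derivable_mul; last exact: IH.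
apply: derivable_mul; first exact: dh.
by apply: derivable_inv; [rewrite gt_eqF// h_gt0|exact: dh].
Qed.

Lemma orthn_is_derive n (t : R) : is_derive t 1 (fun s => orthn (momf (M s)) n)
  ((orthb (momf (M t)) n + orthb (momf (M t)) n.+1) * orthn (momf (M t)) n).
Proof. by apply: is_derive_h_of_coef => i; exact: derivable_coef. Qed.

Lemma ln_orthn_is_derive n (t : R) :
  is_derive t 1 (fun s => ln (orthn (momf (M s)) n))
    (orthb (momf (M t)) n + orthb (momf (M t)) n.+1).
Proof.
apply: is_derive_eq.
  by apply: is_derive_ln_comp; [exact: h_gt0|exact: orthn_is_derive].
by rewrite mulfK// gt_eqF// h_gt0.
Qed.

(* The Hankel determinant A_n(t; lam) for e = false, A_n(t; lam + 1) for
   e = true. *)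
Definition gram (e : bool) n t := \prod_(k < n) orthn (momf (M t)) (e + k.*2).

Lemma gram_gt0 e n t : 0 < gram e n t.
Proof. by apply: prodr_gt0 => i _; exact: h_gt0. Qed.

Let ln_gram e n t :
  ln (gram e n t) = \sum_(k < n) ln (orthn (momf (M t)) (e + k.*2)).
Proof.
rewrite /gram; elim: n => [|n IH]; first by rewrite !big_ord0 ln1.
rewrite !big_ord_recr /= lnM ?IH// posrE; last exact: h_gt0.
exact: gram_gt0.
Qed.

Lemma ln_gram_is_derive n (t : R) :
  is_derive t 1 (fun s => ln (gram true n s / gram false n s))
    (orthb (momf (M t)) n.*2).
Proof.
have -> : (fun s => ln (gram true n s / gram false n s)) = fun s =>
    \sum_(k < n) (ln (orthn (momf (M s)) k.*2.+1) - ln (orthn (momf (M s)) k.*2)).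
  apply/funext => s; rewrite ln_div ?posrE ?gram_gt0// !ln_gram -sumrB.
  by apply: eq_bigr.
apply: is_derive_eq.
  apply: is_derive_sum_fun => i; apply: is_deriveB; exact: ln_orthn_is_derive.
(* The k-th summand is b_(2k+2) - b_(2k); nothing remains at the lower end because b_0 = 0. *)
elim: n => [|n IH]; first by rewrite big_ord0.
by rewrite big_ord_recr /= IH doubleS; ring.
Qed.

(** The quotient is h_(2n) divided by the quotient of [ln_gram_is_derive], so the derivative is
    (b_(2n) + b_(2n+1)) - b_(2n). *)
Lemma ln_gramS_is_derive n (t : R) :
  is_derive t 1 (fun s => ln (gram false n.+1 s / gram true n s))
    (orthb (momf (M t)) n.*2.+1).
Proof.
have -> : (fun s => ln (gram false n.+1 s / gram true n s)) =
    (fun s => ln (orthn (momf (M s)) n.*2)) -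
    (fun s => ln (gram true n s / gram false n s)).
  apply/funext => s; rewrite !fctE !ln_div ?posrE ?gram_gt0//.
  by rewrite !ln_gram big_ord_recr /=; ring.
apply: is_derive_eq.
  apply: is_deriveB; [exact: ln_orthn_is_derive|exact: ln_gram_is_derive].
by rewrite addrAC subrr add0r.
Qed.

(** Successive Gram products differ by one norm, so the right-hand side collapses to h_(2n+2) /
    h_(2n+1). The index starts at [n.+1] because the formula for b_0 contains A_(-1), which is not a
    product of norms. *)
Lemma orthb_even_gram n t : orthb (momf (M t)) n.+1.*2 =
  gram false n.+2 t * gram true n t / (gram false n.+1 t * gram true n.+1 t).
Proof.
have g0 e m := lt0r_neq0 (gram_gt0 e m t).
have h0 m : orthn (momf (M t)) m != 0 := lt0r_neq0 (h_gt0 m t).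
rewrite doubleS /orthb.
have -> : gram false n.+2 t = gram false n.+1 t * orthn (momf (M t)) n.*2.+2.
  by rewrite {1}/gram big_ord_recr /= doubleS.
have -> : gram true n.+1 t = gram true n t * orthn (momf (M t)) n.*2.+1.
  by rewrite {1}/gram big_ord_recr.
by field; rewrite !g0 h0.
Qed.

Lemma orthb_odd_gram n t : orthb (momf (M t)) n.*2.+1 =
  gram false n t * gram true n.+1 t / (gram false n.+1 t * gram true n t).
Proof.
have g0 e m := lt0r_neq0 (gram_gt0 e m t).
have h0 m : orthn (momf (M t)) m != 0 := lt0r_neq0 (h_gt0 m t).
rewrite /orthb.
have -> : gram false n.+1 t = gram false n t * orthn (momf (M t)) n.*2.
  by rewrite {1}/gram big_ord_recr /=.
have -> : gram true n.+1 t = gram true n t * orthn (momf (M t)) n.*2.+1.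
  by rewrite {1}/gram big_ord_recr.
by field; rewrite !g0 h0.
Qed.

End TodaFlow.

(** * Integrals over the half-line and reflection *)

Lemma is_derive_integral_itv (R : realType) (f F : R -> R) (a b : R) : a < b ->
  (forall x : R, a <= x <= b -> is_derive x 1 F (f x)) ->
  (forall x : R, a <= x <= b -> derivable f x 1) ->
  (\int[lebesgue_measure]_(x in `[a, b]) (f x)%:E = (F b - F a)%:E)%E.
Proof.
move=> ab dF df.
have cF (x : R) : a <= x <= b -> {for x, continuous F}.
  move=> /dF [dFx _]; have H := proj1 (derivable1_diffP F x) dFx.
  exact: differentiable_continuous.
rewrite (@continuous_FTC2 R f F a b)//.
- have H := @derivable_within_continuous R _ f `[a, b].
  by refine (H _) => x; rewrite in_itv /=; exact: df.
- split.
  + move=> x; rewrite in_itv /= => /andP[ax xb].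
    by have [] := dF x; rewrite ?(ltW ax) ?(ltW xb).
  + by apply: cvg_at_right_filter; apply: cF; rewrite lexx ltW.
  + by apply: cvg_at_left_filter; apply: cF; rewrite lexx ltW.
- move=> x; rewrite in_itv /= => /andP[ax xb].
  rewrite derive1E; have H : a <= x <= b by rewrite !ltW.
  by have [_] := dF x H.
Qed.

Lemma bigcup_itv_0y (R : realType) (a b : nat -> R) :
  (forall n, 0 < a n) -> (a n @[n --> \oo] --> 0) ->
  (b n @[n --> \oo] --> +oo) ->
  \bigcup_n `[a n, b n]%classic = `]0, +oo[%classic.
Proof.
move=> a0 ca cb; apply/seteqP; split => x /=.
  move=> [n _] /=; rewrite !in_itv /= andbT => /andP[ax _].
  exact: lt_le_trans (a0 n) ax.
rewrite in_itv /= andbT => x0.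
have [N _ HN] : \forall n \near \oo, a n <= x /\ x <= b n.
  near=> n; split; near: n.
    by move/cvgr_le : ca; apply.
  by move/cvgryPge : cb; apply.
exists N => //=; rewrite in_itv /=.
by have [-> ->] := HN N (leqnn N).
Unshelve. all: by end_near. Qed.

(** Monotone convergence on intervals that avoid the possible singularity at 0. The end points are
    arbitrary sequences because an exhaustion is later compared with its image under x^6. *)
Lemma ge0_integral_itv_0y (R : realType) (a b : nat -> R) (f : R -> R) :
  (forall n, 0 < a n) -> (a n @[n --> \oo] --> 0) ->
  (b n @[n --> \oo] --> +oo) ->
  (forall m n, (m <= n)%N -> a n <= a m) ->
  (forall m n, (m <= n)%N -> b m <= b n) ->
  measurable_fun (`]0, +oo[%classic : set R) f ->
  (forall x, 0 < x -> 0 <= f x) ->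
  (\int[lebesgue_measure]_(x in `[a n, b n]) (f x)%:E)%E @[n --> \oo] -->
  (\int[lebesgue_measure]_(x in `]0%R, +oo[) (f x)%:E)%E.
Proof.
move=> a0 ca cb na nb mf f0; rewrite -(bigcup_itv_0y a0 ca cb).
apply: ge0_nondecreasing_set_cvg_integral => //.
- move=> m n mn; apply/subsetPset; apply: subset_itv.
    by rewrite bnd_simp na.
  by rewrite bnd_simp nb.
- move=> n; apply/measurable_EFinP; apply: measurable_funS mf => //.
  move=> x /=; rewrite !in_itv /= andbT => /andP[+ _].
  exact: lt_le_trans.
- move=> n x /=; rewrite in_itv /= => /andP[ax _]; rewrite lee_fin f0//.
  exact: lt_le_trans ax.
Qed.

Lemma ge0_even_integral (R : realType) (f : R -> \bar R) :
  measurable_fun [set: R] f -> (forall x, 0 <= f x)%E ->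
  (forall x, f (- x) = f x) ->
  (\int[lebesgue_measure]_x f x =
    \int[lebesgue_measure]_(x in `]0%R, +oo[) f x +
    \int[lebesgue_measure]_(x in `]0%R, +oo[) f x)%E.
Proof.
move=> mf f0 fN.
have mfS (D : set R) : measurable_fun D f by exact: measurable_funTS.
rewrite -(setUv (`]-oo, 0%R]%classic : set R)) ge0_integral_setU//=; last 3 first.
  exact: measurableC.
  by rewrite setUv.
  exact/disj_setPCl.
rewrite setCitvl; congr (_ + _)%E.
rewrite integral_itv_obnd_cbnd// ge0_integration_by_substitution0//.
by apply: eq_integral => x _; rewrite fN.
Qed.

Lemma ge0_integralN (R : realType) (f : R -> \bar R) :
  measurable_fun [set: R] f -> (forall x, 0 <= f x)%E ->
  (\int[lebesgue_measure]_x f (- x)%R = \int[lebesgue_measure]_x f x)%E.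
Proof.
move=> mf f0.
rewrite -(@ge0_integral_pushforward _ _ (measurableTypeR R) (measurableTypeR R) R
  (-%R : R -> R) _ lebesgue_measure setT f)//=.
by apply: eq_measure_integral => //= A mA _; exact: lebesgue_measureN.
Qed.

(** * The Freud weight and its moments *)

Section FreudWeight.
Variable R : realType.
Implicit Types lam t x : R.
Notation leb := (@lebesgue_measure R).

(** On [1/(n+1), 1] the antiderivative bounds the integral by 1/(a+1), and monotone convergence
    carries the bound to the half-open interval. *)
Lemma integrable_powR01 (a : R) : -1 < a ->
  leb.-integrable (`]0, 1]%classic : set R) (fun x => (x `^ a)%:E).
Proof.
move=> a1; apply/integrableP; split.
  apply/measurable_EFinP; apply: measurable_funTS; exact: measurable_powR.
have a10 : 0 < a + 1 by rewrite -ltrBlDr sub0r.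
rewrite (_ : \int[_]_(x in _) _ = \int[leb]_(x in `]0%R, 1%R]) (x `^ a)%:E)%E;
  last by apply: eq_integral => x _; rewrite gee0_abs// lee_fin powR_ge0.
apply: (@le_lt_trans _ _ ((a + 1)^-1)%:E); last by rewrite ltry.
rewrite itv_open_bnd_bigcup.
have cv : (\int[leb]_(x in `[(0 + i.+1%:R^-1)%R, 1%R]) (x `^ a)%:E)%E @[i --> \oo] -->
    (\int[leb]_(x in \bigcup_i `[(0 + i.+1%:R^-1)%R, 1%R]%classic) (x `^ a)%:E)%E.
  apply: ge0_nondecreasing_set_cvg_integral => //.
  - move=> m n mn; apply/subsetPset; apply: subset_itvr.
    by rewrite bnd_simp !add0r lef_pV2 ?posrE// ler_nat ltnS.
  - move=> n; apply/measurable_EFinP; apply: measurable_funTS.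
    exact: measurable_powR.
  - by move=> n x _; rewrite lee_fin powR_ge0.
rewrite -(cvg_lim _ cv)//; apply: lime_le; first by apply/cvg_ex; eexists; exact: cv.
near=> n; rewrite add0r.
have n0 : (0 : R) < n.+1%:R^-1 by rewrite invr_gt0.
have n1 : n.+1%:R^-1 < (1 : R).
  by rewrite invf_lt1// ltr1n ltnS; near: n; exact: nbhs_infty_gt.
have -> : (\int[leb]_(x in `[(n.+1%:R^-1)%R, 1%R]) (x `^ a)%:E =
    ((a + 1)^-1 * 1 `^ (a + 1) - (a + 1)^-1 * n.+1%:R^-1 `^ (a + 1))%R%:E)%E.
  refine (@is_derive_integral_itv R (fun x => x `^ a)
    (fun x => (a + 1)^-1 * x `^ (a + 1)) _ _ n1 _ _).
    move=> x /andP[xn _]; have x0 : 0 < x by exact: lt_le_trans xn.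
    have H := is_deriveZ (a + 1)^-1 (is_derive1_powR (a + 1) x0).
    refine (is_derive_eq H _).
    by rewrite /GRing.scale /= addrK mulrA mulVf ?mul1r// gt_eqF.
  move=> x /andP[xn _]; have x0 : 0 < x by exact: lt_le_trans xn.
  by have [H _] := is_derive1_powR a x0; refine H.
by rewrite powR1 mulr1 lee_fin gerBl mulr_ge0 ?powR_ge0// invr_ge0 ltW.
Unshelve. all: by end_near. Qed.

Lemma measurable_freud_weight lam t : measurable_fun setT (freud_weight lam t).
Proof.
apply: measurable_funM.
  apply: (measurableT_comp (measurable_powR _)) => //; exact: measurable_normr.
apply: measurableT_comp => //; apply: measurable_funD.
  by apply: measurable_funN; exact: measurable_funX.
by apply: measurable_funM => //; exact: measurable_funX.
Qed.

Lemma freud_weight_ge0 lam t x : 0 <= freud_weight lam t x.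
Proof. by rewrite mulr_ge0 ?powR_ge0 ?expR_ge0. Qed.

Lemma freud_weight_gt0 lam t x : x != 0 -> 0 < freud_weight lam t x.
Proof. by move=> x0; rewrite mulr_gt0 ?expR_gt0// powR_gt0// normr_gt0. Qed.

Lemma freud_weightN lam t x : freud_weight lam t (- x) = freud_weight lam t x.
Proof.
have E6 : (- x) ^+ 6 = x ^+ 6 by rewrite -[6%N]/(2 * 3)%N !exprM sqrrN.
by rewrite /freud_weight normrN E6 sqrrN.
Qed.

Lemma freud_weightD lam t x k : -1 < lam ->
  freud_weight (lam + k%:R) t x = x ^+ k.*2 * freud_weight lam t x.
Proof.
move=> l1; rewrite /freud_weight mulrA; congr (_ * _).
case: k => [|k]; first by rewrite addr0 expr0 mul1r.
have k1 : 1 <= k.+1%:R :> R by rewrite ler1n.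
(* At the origin the exponent on the left exceeds 1, so the power is 0 and matches the factor
   x^(2k+2); a zero exponent would have given 1. *)
have [->|x0] := eqVneq x 0.
  by rewrite normr0 powR0 ?expr0n ?mul0r// gt_eqF//; lra.
have -> : 2 * (lam + k.+1%:R) + 1 = (2 * lam + 1) + (k.+1.*2)%:R.
  by rewrite -mul2n natrM; ring.
rewrite powRD ?normr_eq0 ?x0 ?implybT// mulrC powR_mulrn//.
by congr (_ * _); rewrite -normrX ger0_norm// -mul2n exprM exprn_ge0 ?sqr_ge0.
Qed.

Lemma freud_weight_le01 lam t x : 0 < x <= 1 ->
  freud_weight lam t x <= expR `|t| * x `^ (2 * lam + 1).
Proof.
move=> /andP[x0 x1]; rewrite /freud_weight (gtr0_norm x0) mulrC.
rewrite ler_wpM2r ?powR_ge0// ler_expR.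
have x6 : 0 <= x ^+ 6 by rewrite exprn_ge0 ?ltW.
have x2 : 0 <= x ^+ 2 <= 1 by rewrite exprn_ge0 ?exprn_ile1 ?(ltW x0).
have := ler_norm t; have := normr_ge0 t; nra.
Qed.

(** With y = x^2 the power is at most (N+1)! e^y, so relative to e^(-y) the exponent left to bound
    is (t + 2) y - y^3. For y up to K + 1 it is at most K (K + 1), and beyond that K y is at most
    y^3. *)
Lemma freud_weight_le_gauss lam t : exists C : R,
  forall x, 1 <= x -> freud_weight lam t x <= C * gauss_fun x.
Proof.
pose N := (Num.Def.archi_bound `|2 * lam + 1|).
pose K := `|t + 2|.
exists (N.+1`!%:R * expR (K * (K + 1))) => x x1.
have x0 : 0 < x by exact: lt_le_trans x1.
have y1 : 1 <= x ^+ 2 by rewrite exprn_ege1.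
have xN : x `^ (2 * lam + 1) <= N.+1`!%:R * expR (x ^+ 2).
  apply: (@le_trans _ _ ((x ^+ 2) ^+ N.+1)).
    apply: (@le_trans _ _ (x ^+ N.+1)).
      rewrite -powR_mulrn ?(ltW x0)//; apply: ler_powR => //.
      apply: le_trans (ler_norm _) _; apply: ltW.
      have := archi_boundP (normr_ge0 (2 * lam + 1)); rewrite -/N.
      by move=> H; apply: (lt_le_trans H); rewrite ler_nat.
    apply: lerXn2r; rewrite ?nnegrE ?(ltW x0) ?exprn_ge0 ?(ltW x0)//.
    by rewrite expr2 ler_peMl// ltW.
  have f0 : 0 < N.+1`!%:R :> R by rewrite ltr0n fact_gt0.
  rewrite mulrC -ler_pdivrMr//.
  apply: le_trans (expR_ge1Dxn N (le_trans ler01 y1)).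
  by rewrite lerDr.
rewrite /freud_weight (gtr0_norm x0) /gauss_fun.
apply: (@le_trans _ _ (N.+1`!%:R * expR (x ^+ 2) * expR (- x ^+ 6 + t * x ^+ 2))).
  by rewrite ler_wpM2r ?expR_ge0.
rewrite -!mulrA -!expRD ler_wpM2l ?ler0n// ler_expR.
have -> : x ^+ 6 = (x ^+ 2) ^+ 3 by rewrite -exprM.
move: y1; set y := x ^+ 2 => y1.
have K0 : 0 <= K := normr_ge0 _.
have tK : t + 2 <= K := ler_norm _.
have [yK|yK] := leP y (K + 1).
  have : 0 <= y ^+ 3 by rewrite exprn_ge0// (le_trans ler01).
  nra.
have y2 : K * y <= y ^+ 3.
  by rewrite exprSr ler_wpM2r ?(le_trans ler01 y1)//; nra.
nra.
Qed.

(** By evenness the half-line suffices. Up to 1 the weight is compared with x^(2 lam + 1), whose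
    exponent exceeds -1, and beyond 1 with a Gaussian. *)
Lemma integrable_freud_weight lam t : -1 < lam ->
  leb.-integrable setT (EFin \o freud_weight lam t).
Proof.
move=> l1; have mw := measurable_freud_weight lam t.
have mwE (D : set R) : measurable_fun D (EFin \o freud_weight lam t).
  by apply/measurable_EFinP; exact: measurable_funTS.
apply/integrableP; split; first exact: mwE.
rewrite (_ : \int[_]_(x in _) _ = \int[leb]_x (freud_weight lam t x)%:E)%E; last first.
  by apply: eq_integral => x _; rewrite /= ger0_norm// freud_weight_ge0.
rewrite ge0_even_integral//; first last.
- by move=> x; rewrite freud_weightN.
- by move=> x; rewrite lee_fin freud_weight_ge0.
suff : (\int[leb]_(x in `]0%R, +oo[) (freud_weight lam t x)%:E < +oo)%E.
  by move=> ?; apply: lte_add_pinfty.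
rewrite (@itv_bndbnd_setU _ _ _ (BRight (1 : R))) ?bnd_simp//.
rewrite ge0_integral_setU//=; last 3 first.
  exact: mwE.
  by move=> x _; rewrite lee_fin freud_weight_ge0.
  by apply/disj_setPS => x /= []; rewrite !in_itv /= => /andP[_ x1]; rewrite ltNge x1.
apply: lte_add_pinfty.
  have a1 : -1 < 2 * lam + 1 by lra.
  have H : leb.-integrable (`]0, 1]%classic : set R)
      (fun x => ((expR `|t|)%:E * (x `^ (2 * lam + 1))%:E)%E).
    by apply: integrableZl => //; exact: integrable_powR01.
  apply: le_lt_trans _ (integrable_lty _ H) => //.
  apply: ge0_le_integral => //=.
  - by move=> x _; rewrite lee_fin freud_weight_ge0.
  - exact: mwE.
  - by case/integrableP: H.
  - move=> x; rewrite in_itv /= => x01.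
    by rewrite -EFinM lee_fin freud_weight_le01.
have [C HC] := freud_weight_le_gauss lam t.
have ig : leb.-integrable (`]1, +oo[%classic : set R) (EFin \o gauss_fun).
  exact: integrableS integrableT_gauss.
have H : leb.-integrable (`]1, +oo[%classic : set R)
    (fun x => (C%:E * (gauss_fun x)%:E)%E) by exact: integrableZl.
apply: le_lt_trans _ (integrable_lty _ H) => //.
apply: ge0_le_integral => //=.
- by move=> x _; rewrite lee_fin freud_weight_ge0.
- exact: mwE.
- by case/integrableP: H.
- move=> x; rewrite in_itv /= andbT => x1.
  by rewrite -EFinM lee_fin HC// ltW.
Qed.

End FreudWeight.

Lemma countable_poly_roots (R : realType) (p : {poly R}) : p != 0 ->
  countable [set x | root p x].
Proof.
move=> p0; apply: finite_set_countable; apply: contrapT => inf.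
have [B Bp sB] := infinite_set_fset (size p) inf.
have aB : all (root p) (finmap.enum_fset B) by apply/allP => x xB; exact: Bp.
by have := max_poly_roots p0 aB (finmap.fset_uniq B); rewrite ltnNge sB.
Qed.

(** * Derivatives of the moments and positivity of the moment functional *)

Section Moments.
Variable R : realType.
Implicit Types lam t x : R.
Notation leb := (@lebesgue_measure R).

Lemma freud_weight_is_derive lam (s : R) x : -1 < lam ->
  is_derive s 1 (fun s => freud_weight lam s x) (freud_weight (lam + 1) s x).
Proof.
move=> l1; have := @freud_weightD R lam s x 1 l1; rewrite mulr1n => ->.
have d1 : is_derive s 1 (fun s => - x ^+ 6 + s * x ^+ 2) (x ^+ 2).
  have H := is_deriveD (is_derive_cst (- x ^+ 6) s 1)
    (is_deriveM (is_derive_id s 1) (is_derive_cst (x ^+ 2) s 1)).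
  refine (is_derive_eq H _).
  by rewrite add0r scaler0 add0r /GRing.scale /= mulr1.
have H := is_deriveZ (`|x| `^ (2 * lam + 1))
  (@is_derive1_comp R expR (fun s => - x ^+ 6 + s * x ^+ 2) s _ _
    (is_derive_expR _) d1).
refine (is_derive_eq H _).
by rewrite /GRing.scale /= /freud_weight; ring.
Qed.

Lemma freud_weight_homo lam x : {homo (fun t => freud_weight lam t x) : s t / s <= t}.
Proof.
move=> s t st; rewrite ler_wpM2l ?powR_ge0// ler_expR lerD2l ler_wpM2r//.
by rewrite sqr_ge0.
Qed.

Lemma mu0_is_derive lam t : -1 < lam -> is_derive t 1 (mu0 lam) (mu0 (lam + 1) t).
Proof.
move=> l1; have l2 : -1 < lam + 1 by lra.
have tI : (`]t - 1, t + 1[%classic : set R) t by rewrite /= in_itv /=; lra.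
have intf (s : R) : (`]t - 1, t + 1[%classic : set R) s ->
  leb.-integrable setT (EFin \o freud_weight lam s).
  by move=> _; exact: integrable_freud_weight.
have derf (s x : R) : (`]t - 1, t + 1[%classic : set R) s -> setT x ->
    derivable (fun s => freud_weight lam s x) s 1.
  by move=> _ _; have [H _] := freud_weight_is_derive s x l1; refine H.
have d1E (s x : R) : partial1of2 (freud_weight lam) s x = freud_weight (lam + 1) s x.
  rewrite partial1of2E; have [_ H] := freud_weight_is_derive s x l1; exact: H.
(* The weight increases with t, so its value at the right end t + 1 dominates the derivative on the
   whole neighbourhood. *)
have G_ub (s x : R) : (`]t - 1, t + 1[%classic : set R) s -> setT x ->
    `|partial1of2 (freud_weight lam) s x| <= freud_weight (lam + 1) (t + 1) x.
  rewrite /= in_itv /= => /andP[_ st] _.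
  by rewrite d1E ger0_norm ?freud_weight_ge0// freud_weight_homo// ltW.
have G0 (x : R) : 0 <= freud_weight (lam + 1) (t + 1) x by exact: freud_weight_ge0.
have iG := integrable_freud_weight (t + 1) l2.
have D1 := derivable_under_integral measurableT tI intf derf G0 iG G_ub.
have D2 := differentiation_under_integral measurableT tI intf derf G0 iG G_ub.
apply: DeriveDef; first by refine D1.
rewrite -derive1E; apply: etrans D2 _.
by apply: eq_Rintegral => x _; exact: d1E.
Qed.

Lemma mu0_derive1n lam k t : -1 < lam ->
  derive1n k (mu0 lam) t = mu0 (lam + k%:R) t.
Proof.
move=> l1; elim: k t => [|k IH] t; first by rewrite derive1n0 addr0.
have lk : -1 < lam + k%:R by rewrite ltr_wpDr.
rewrite derive1nS (_ : derive1n k (mu0 lam) = mu0 (lam + k%:R)); last first.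
  by apply/funext.
rewrite derive1E; have [_ H] := mu0_is_derive t lk; rewrite -natr1 addrA.
exact: H.
Qed.

(** The factor x^i of an even moment is absorbed into the exponent of the weight, so that
    derivatives in t are shifts of lam; [integral_moment] recovers the integral. *)
Definition moment lam t (i : nat) : R :=
  if odd i then 0 else mu0 (lam + i./2%:R) t.

Lemma measurable_expM_freud lam t i :
  measurable_fun setT (fun x => x ^+ i * freud_weight lam t x).
Proof.
apply: measurable_funM; first exact: measurable_funX.
exact: measurable_freud_weight.
Qed.

Lemma integrable_moment lam t i : -1 < lam ->
  leb.-integrable setT (fun x => (x ^+ i * freud_weight lam t x)%:E).
Proof.
move=> l1.
have even k : leb.-integrable setT (fun x => (x ^+ k.*2 * freud_weight lam t x)%:E).
  apply: eq_integrable (integrable_freud_weight t (_ : -1 < lam + k%:R)) => //.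
    by move=> x _; rewrite /= freud_weightD.
  by rewrite ltr_wpDr.
(* With k the half of i, |x|^i is at most x^(2k) + x^(2k+2); for odd i this is |x| <= 1 + x^2. *)
have iD := integrableD measurableT (even i./2) (even (i./2).+1).
apply: le_integrable iD => //.
  by apply/measurable_EFinP; exact: measurable_expM_freud.
move=> x _; rewrite /= lee_fin -mulrDl !normrM ler_wpM2r//.
apply: le_trans (ler_norm _).
have xiE : x ^+ i = x ^+ odd i * x ^+ i./2.*2 by rewrite -exprD odd_double_half.
have a0 : 0 <= x ^+ i./2.*2 by rewrite -mul2n exprM exprn_ge0// sqr_ge0.
rewrite doubleS 2!exprS mulrA xiE normrM (ger0_norm a0) -[X in X + _]mul1r -mulrDl.
rewrite ler_wpM2r//; case: (odd i); last by rewrite expr0 normr1 lerDl sqr_ge0.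
rewrite expr1; have := sqr_ge0 (`|x| - 1); rewrite -expr2 -(real_normK (num_real x)).
nra.
Qed.

Lemma integral_moment lam t i : -1 < lam ->
  \int[leb]_x (x ^+ i * freud_weight lam t x) = moment lam t i.
Proof.
move=> l1; rewrite /moment; case: ifPn => oi; last first.
  apply: eq_Rintegral => x _; rewrite freud_weightD//.
  by rewrite -[in LHS](odd_double_half i) (negPf oi).
set f := fun x => (x ^+ i * freud_weight lam t x)%:E.
have mf : measurable_fun setT f by apply/measurable_EFinP; exact: measurable_expM_freud.
have fN x : f (- x) = (- f x)%E.
  by rewrite /f freud_weightN exprNn -signr_odd oi expr1 mulN1r mulNr EFinN.
rewrite /Rintegral -/f integralE.
(* Reflection exchanges the positive and negative parts of an odd function. *)
have -> : (\int[leb]_x f^\- x = \int[leb]_x f^\+ x)%E.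
  rewrite -(@ge0_integralN _ f^\+%E)//; last exact: measurable_funepos.
  apply: eq_integral => x _.
  by rewrite funeposE funenegE fN.
by rewrite subee// integrable_pos_fin_num//; exact: integrable_moment.
Qed.

Lemma integrable_poly_freud lam t (p : {poly R}) : -1 < lam ->
  leb.-integrable setT (fun x => (p.[x] * freud_weight lam t x)%:E) /\
  \int[leb]_x (p.[x] * freud_weight lam t x) = momf (moment lam t) p.
Proof.
move=> l1; rewrite /momf.
suff [H1 H2] : leb.-integrable setT (fun x =>
      (\sum_(i < size p) p`_i * (x ^+ i * freud_weight lam t x))%:E) /\
    \int[leb]_x (\sum_(i < size p) p`_i * (x ^+ i * freud_weight lam t x)) =
    \sum_(i < size p) p`_i * moment lam t i.
  have E x : \sum_(i < size p) p`_i * (x ^+ i * freud_weight lam t x) =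
      p.[x] * freud_weight lam t x.
    by rewrite horner_coef mulr_suml; apply: eq_bigr => i _; rewrite mulrA.
  split; last by rewrite -H2; apply: eq_Rintegral => x _; rewrite E.
  by apply: eq_integrable H1 => // x _; rewrite E.
elim: (size p) => [|n [IH1 IH2]].
  split; last first.
    rewrite big_ord0; under eq_Rintegral do rewrite big_ord0.
    by rewrite Rintegral_cst// mul0r.
  by under eq_fun do rewrite big_ord0; exact: integrable0.
have iZ : leb.-integrable setT
    (fun x => (p`_n * (x ^+ n * freud_weight lam t x))%:E).
  under eq_fun do rewrite EFinM.
  by apply: integrableZl => //; exact: integrable_moment.
split.
  under eq_fun do rewrite big_ord_recr /= EFinD.
  exact: integrableD.
under eq_Rintegral do rewrite big_ord_recr /=.
rewrite RintegralD//.
rewrite IH2 big_ord_recr /= RintegralZl// ?integral_moment//.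
exact: integrable_moment.
Qed.

Lemma integral_poly_freud lam t (p : {poly R}) : -1 < lam ->
  (\int[leb]_x (p.[x] * freud_weight lam t x)%:E = (momf (moment lam t) p)%:E)%E.
Proof.
move=> l1; have [H1 <-] := integrable_poly_freud t p l1.
by rewrite /Rintegral fineK//; exact: integrable_fin_num.
Qed.

(** If the integral of p^2 times the weight were 0, the integrand would vanish almost everywhere,
    and [0, 1] would be covered by a null set and finitely many roots. *)
Lemma momf_freud_gt0 lam t (p : {poly R}) : -1 < lam -> p != 0 ->
  0 < momf (moment lam t) (p * p).
Proof.
move=> l1 p0; have [H1 H2] := integrable_poly_freud t (p * p) l1.
have ge0 x : 0 <= (p * p).[x] * freud_weight lam t x.
  by rewrite mulr_ge0 ?freud_weight_ge0// hornerM -expr2 sqr_ge0.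
rewrite lt_def -H2 Rintegral_ge0// andbT; apply/negP => /eqP I0.
have {}I0 : (\int[leb]_x `|((p * p).[x] * freud_weight lam t x)%:E| = 0)%E.
  under eq_integral do rewrite gee0_abs ?lee_fin//.
  by rewrite integral_poly_freud// -H2 I0.
have mf : measurable_fun setT (fun x => ((p * p).[x] * freud_weight lam t x)%:E).
  by case/integrableP : H1.
have [N [mN N0 subN]] := proj1 (ae_eq_integral_abs leb measurableT mf) I0.
pose C : set R := [set x | root ('X * p) x].
have cC : countable C by apply: countable_poly_roots; rewrite mulf_neq0 ?polyX_eq0.
have mC : measurable C by apply: countable_measurable.
have sub : (`[0, 1]%classic : set R) `<=` N `|` C.
  move=> x _; have [Cx|] := boolP (root ('X * p) x); first by right.
  rewrite rootM rootX negb_or => /andP[x0 px]; left.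
  apply: subN => /= /(_ Logic.I) [] /eqP.
  rewrite mulf_eq0 (gt_eqF (freud_weight_gt0 _ _ x0)) orbF hornerM mulf_eq0 orbb.
  exact/negP.
have : (leb (`[0%R, 1%R]%classic : set R) <= 0)%E.
  apply: (@le_trans _ _ (leb (N `|` C))).
    by apply: le_measure => //; rewrite inE//; exact: measurableU.
  apply: le_trans (measureU2 leb mN mC) _.
  by rewrite [X in (X + _)%E]N0 [X in (_ + X)%E](countable_lebesgue_measure0 cC) adde0.
by rewrite lebesgue_measure_itv /= lte_fin ltr01 -EFinB lee_fin subr0 ler10.
Qed.

End Moments.

(** * The Gamma function *)

Section GammaMoments.
Variable R : realType.
Implicit Types lam t x : R.
Notation leb := (@lebesgue_measure R).

Lemma cvg_harmonicS0 : (n.+1%:R^-1 : R) @[n --> \oo] --> (0 : R).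
Proof. exact: cvg_harmonic. Qed.

Lemma cvg_natSy : (n.+1%:R : R) @[n --> \oo] --> +oo.
Proof. by rewrite (cvg_shiftS (fun n => n%:R : R)); exact: cvgr_idn. Qed.

Lemma integral_itv_expn6 (G : R -> R) (a b : R) : 0 < a -> a < b ->
  {in `]0, +oo[, continuous G} ->
  (\int[leb]_(x in `[(a ^+ 6)%R, (b ^+ 6)%R]) (G x)%:E =
   \int[leb]_(x in `[a, b]) (G (x ^+ 6) * (6 * x ^+ 5))%:E)%E.
Proof.
move=> a0 ab cG; pose F := fun x : R => x ^+ 6.
have dF x : is_derive x 1 F (6 * x ^+ 5).
  have H := is_deriveX 6 (is_derive_id x 1); refine (is_derive_eq H _).
  by rewrite /GRing.scale /= mulr1.
have F'E : F^`()%classic = fun x => 6 * x ^+ 5.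
  by apply/funext => x; rewrite derive1E; have [_ H] := dF x; exact: H.
have cF' x : {for x, continuous (fun x : R => 6 * x ^+ 5)}.
  apply: cvgM; first exact: cvg_cst.
  exact: exprn_continuous.
have cF x : {for x, continuous F} by exact: exprn_continuous.
rewrite (@integration_by_substitution_increasing R F G a b (ltW ab)).
- by apply: eq_integral => x _; rewrite !fctE F'E.
- move=> x y; rewrite !in_itv /= => /andP[ax _] /andP[ay _] xy.
  by rewrite /F ltrXn2r// (le_trans (ltW a0)).
- by move=> x _; rewrite F'E; exact: cF'.
- rewrite F'E; apply/cvg_ex; exists (6 * a ^+ 5).
  by apply: cvg_at_right_filter; exact: cF'.
- rewrite F'E; apply/cvg_ex; exists (6 * b ^+ 5).
  by apply: cvg_at_left_filter; exact: cF'.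
- split.
  + by move=> x _; have [H _] := dF x; exact: H.
  + by apply: cvg_at_right_filter; exact: cF.
  + by apply: cvg_at_left_filter; exact: cF.
- apply: continuous_in_subspaceT => x; rewrite inE /= in_itv /= => /andP[ax _].
  apply: cG; rewrite in_itv /= andbT; apply: lt_le_trans ax.
  by rewrite exprn_gt0.
Qed.

Lemma continuous_powR_expRN (s : R) :
  {in `]0, +oo[, continuous (fun u : R => u `^ s * expR (- u))}.
Proof.
move=> x; rewrite in_itv /= andbT => x0.
have [d1 _] := is_derive1_powR s x0.
have [d2 _] := @is_derive1_comp R expR (fun u => - u) x _ _ (is_derive_expR _)
  (is_deriveN (is_derive_id x 1)).
have H := proj1 (derivable1_diffP _ x) (derivableM d1 d2).
have C := differentiable_continuous H; exact: C.
Qed.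

(** With u = x^6 and s = (lam + 1) / 3, u^(s-1) du becomes 6 x^(6 (s - 1) + 5) dx, and 6 (s - 1) + 5
    = 2 lam + 1. The substitution is made on compact intervals, then both sides pass to the
    limit. *)
Lemma Gamma_freud_half lam : -1 < lam ->
  (\int[leb]_(u in `]0%R, +oo[) (u `^ ((lam + 1) / 3 - 1) * expR (- u))%:E =
   6%:E * \int[leb]_(x in `]0%R, +oo[) (freud_weight lam 0 x)%:E)%E.
Proof.
move=> l1; set s := (lam + 1) / 3.
have mw : measurable_fun (`]0, +oo[%classic : set R) (freud_weight lam 0).
  by apply: measurable_funTS; exact: measurable_freud_weight.
have inv_mono m n : (m <= n)%N -> (n.+1%:R^-1 : R) <= m.+1%:R^-1.
  by move=> mn; rewrite lef_pV2 ?posrE// ler_nat ltnS.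
have nat_mono m n : (m <= n)%N -> (m.+1%:R : R) <= n.+1%:R.
  by move=> mn; rewrite ler_nat ltnS.
have c1 : (\int[leb]_(x in `[(n.+1%:R^-1)%R, (n.+1%:R)%R])
      (6 * freud_weight lam 0 x)%:E)%E @[n --> \oo] -->
    (\int[leb]_(x in `]0%R, +oo[) (6 * freud_weight lam 0 x)%:E)%E.
  apply: (@ge0_integral_itv_0y R (fun n => n.+1%:R^-1) (fun n => n.+1%:R)) => //.
  - exact: cvg_harmonicS0.
  - exact: cvg_natSy.
  - exact: measurable_funM.
  - by move=> x _; rewrite mulr_ge0// freud_weight_ge0.
have c2 : (\int[leb]_(u in `[(n.+1%:R^-1 ^+ 6)%R, (n.+1%:R ^+ 6)%R])
      (u `^ (s - 1) * expR (- u))%:E)%E @[n --> \oo] -->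
    (\int[leb]_(u in `]0%R, +oo[) (u `^ (s - 1) * expR (- u))%:E)%E.
  apply: (@ge0_integral_itv_0y R (fun n => n.+1%:R^-1 ^+ 6)
    (fun n => n.+1%:R ^+ 6)) => //.
  - apply: (squeeze_cvgr _ (cvg_cst 0) cvg_harmonicS0).
    near=> n; rewrite exprn_ge0 ?invr_ge0//=.
    have i1 : (n.+1%:R^-1 : R) <= 1 by rewrite invf_le1// ler1n.
    by rewrite exprS ger_pMr ?invr_gt0// exprn_ile1// invr_ge0.
  - apply/cvgryPge => A; move/cvgryPge : cvg_natSy => /(_ A).
    apply: filterS => n An; apply: le_trans An _.
    by rewrite exprS ler_pMr// exprn_ege1// ler1n.
  - by move=> m n mn /=; rewrite lerXn2r ?nnegrE ?invr_ge0// inv_mono.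
  - by move=> m n mn /=; rewrite lerXn2r ?nnegrE// nat_mono.
  - apply: open_continuous_measurable_fun => // x; rewrite inE /= => x0.
    exact: continuous_powR_expRN.
  - by move=> x _; rewrite mulr_ge0 ?powR_ge0 ?expR_ge0.
transitivity (\int[leb]_(x in `]0%R, +oo[) (6 * freud_weight lam 0 x)%:E)%E; last first.
  under eq_integral do rewrite EFinM.
  rewrite ge0_integralZl//; first exact/measurable_EFinP.
  by move=> x _; rewrite lee_fin freud_weight_ge0.
apply: (cvg_unique _ c2) => //; apply: cvg_trans c1.
(* For n = 0 both intervals shrink to the point 1 and the strict order of the end points fails, so
   the comparison is only eventual. *)
apply: near_eq_cvg; near=> n.
have n0 : (0 : R) < n.+1%:R^-1 by rewrite invr_gt0.
have n1 : n.+1%:R^-1 < (n.+1%:R : R).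
  have n2 : (1 : R) < n.+1%:R by rewrite ltr1n ltnS; near: n; exact: nbhs_infty_gt.
  by apply: (lt_trans _ n2); rewrite invf_lt1.
rewrite (integral_itv_expn6 n0 n1 (@continuous_powR_expRN (s - 1))).
apply: eq_integral => x; rewrite inE /= in_itv /= => /andP[nx _].
have x0 : 0 < x by exact: lt_le_trans nx.
rewrite /freud_weight mul0r addr0 (gtr0_norm x0); congr EFin.
have -> : (x ^+ 6) `^ (s - 1) = x `^ (6 * (s - 1)).
  by rewrite -powR_mulrn ?ltW// -powRrM.
have -> : x `^ (2 * lam + 1) = x `^ (6 * (s - 1)) * x ^+ 5.
  have x5 : (6 * (s - 1) + 5%:R == 0) ==> (x != 0) by rewrite (gt_eqF x0) implybT.
  rewrite -[x ^+ 5]powR_mulrn ?ltW// -(powRD x5).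
  by congr (x `^ _); rewrite /s; field.
by ring.
Unshelve. all: by end_near. Qed.

Lemma mu0_half lam t : -1 < lam ->
  mu0 lam t = 2 * \int[leb]_(x in `]0, +oo[) freud_weight lam t x.
Proof.
move=> l1; rewrite /mu0 /Rintegral ge0_even_integral; first last.
- by move=> x; rewrite freud_weightN.
- by move=> x; rewrite lee_fin freud_weight_ge0.
- by apply/measurable_EFinP; exact: measurable_freud_weight.
have : (\int[leb]_(x in `]0%R, +oo[) (freud_weight lam t x)%:E)%E \is a fin_num.
  apply: integrable_fin_num => //.
  exact: integrableS (integrable_freud_weight t l1).
by move: (integral _ _ _) => I fin; rewrite fineD// mulr_natl mulr2n.
Qed.

Lemma Gamma_freud lam : -1 < lam -> Gamma ((lam + 1) / 3) = 3 * mu0 lam 0.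
Proof.
move=> l1; rewrite mu0_half// /Gamma /Rintegral Gamma_freud_half//.
have : (\int[leb]_(x in `]0%R, +oo[) (freud_weight lam 0 x)%:E)%E \is a fin_num.
  apply: integrable_fin_num => //.
  exact: integrableS (integrable_freud_weight 0 l1).
by move: (integral _ _ _) => I fin; rewrite fineM// /=; ring.
Qed.

Lemma cvg_Rintegral_freud lam t : -1 < lam ->
  \int[leb]_(x in `[n.+1%:R^-1, n.+1%:R]) freud_weight lam t x @[n --> \oo] -->
  \int[leb]_(x in `]0, +oo[) freud_weight lam t x.
Proof.
move=> l1; apply: fine_cvg; rewrite fineK; last first.
  apply: integrable_fin_num => //.
  exact: integrableS (integrable_freud_weight t l1).
apply: (@ge0_integral_itv_0y R (fun n => n.+1%:R^-1) (fun n => n.+1%:R)) => //.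
- exact: cvg_harmonicS0.
- exact: cvg_natSy.
- by move=> m n mn /=; rewrite lef_pV2 ?posrE// ler_nat ltnS.
- by move=> m n mn /=; rewrite ler_nat ltnS.
- by apply: measurable_funTS; exact: measurable_freud_weight.
- by move=> x _; rewrite freud_weight_ge0.
Qed.

(** * The moment recurrence at t = 0 *)

Let prim lam x := x `^ (2 * lam + 2) * expR (- x ^+ 6).

(** Since 2 (lam + 1/2) + 1 = 2 lam + 2, the boundary terms are values of another Freud weight and
    inherit its bounds near 0 and at infinity. *)
Let primE lam x : 0 < x -> prim lam x = freud_weight (lam + 1 / 2) 0 x.
Proof.
move=> x0; rewrite /prim /freud_weight mul0r addr0 (gtr0_norm x0).
by congr (x `^ _ * _); field.
Qed.

Let cvg_prim0 lam : -1 < lam -> prim lam n.+1%:R^-1 @[n --> \oo] --> (0 : R).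
Proof.
move=> l1.
have c0 : n.+1%:R^-1 `^ (2 * (lam + 1 / 2) + 1) @[n --> \oo] --> (0 : R).
  have p0 : 0 < 2 * (lam + 1 / 2) + 1 by lra.
  have := proj1 (cvg_at_rightP (fun a : R => a `^ (2 * (lam + 1 / 2) + 1)) 0 0)
    (powR_cvg0 p0).
  by apply; split; [move=> n; rewrite invr_gt0|exact: cvg_harmonicS0].
apply: (squeeze_cvgr _ (cvg_cst 0) c0); near=> n.
have i0 : (0 : R) < n.+1%:R^-1 by rewrite invr_gt0.
rewrite primE// freud_weight_ge0/=.
apply: le_trans (@freud_weight_le01 R _ _ _ _) _; last by rewrite normr0 expR0 mul1r.
by rewrite i0 invf_le1// ler1n.
Unshelve. all: by end_near. Qed.

Let cvg_primy lam : prim lam n.+1%:R @[n --> \oo] --> (0 : R).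
Proof.
have [C HC] := freud_weight_le_gauss (lam + 1 / 2) 0.
have c0 : C * gauss_fun n.+1%:R @[n --> \oo] --> (0 : R).
  rewrite -[X in _ --> X](mulr0 C); apply: cvgMr.
  exact: (cvg_comp _ _ cvg_natSy cvg_gauss_fun).
apply: (squeeze_cvgr _ (cvg_cst 0) c0); near=> n.
by rewrite primE// freud_weight_ge0/= HC// ler1n.
Unshelve. all: by end_near. Qed.

Let dprim lam x := (2 * lam + 2) * (x `^ (2 * lam + 1) * expR (- x ^+ 6)) -
  6 * (x `^ (2 * (lam + 3) + 1) * expR (- x ^+ 6)).

Let expRN6_is_derive (x : R) :
  is_derive x 1 (fun x => expR (- x ^+ 6)) (expR (- x ^+ 6) * (- (6 * x ^+ 5))).
Proof.
have d6 : is_derive x 1 (fun x => - x ^+ 6) (- (6 * x ^+ 5)).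
  have H := is_deriveN (is_deriveX 6 (is_derive_id x 1)).
  by refine (is_derive_eq H _); rewrite /GRing.scale /= mulr1.
exact: (@is_derive1_comp R expR (fun x => - x ^+ 6) x _ _ (is_derive_expR _) d6).
Qed.

Let prim_is_derive lam (x : R) : 0 < x -> is_derive x 1 (prim lam) (dprim lam x).
Proof.
move=> x0.
have H := is_deriveM (is_derive1_powR (2 * lam + 2) x0) (expRN6_is_derive x).
refine (is_derive_eq H _); rewrite /GRing.scale /= /dprim.
have -> : 2 * lam + 2 - 1 = 2 * lam + 1 by ring.
have -> : x `^ (2 * (lam + 3) + 1) = x `^ (2 * lam + 2) * x ^+ 5.
  have x5 : (2 * lam + 2 + 5%:R == 0) ==> (x != 0) by rewrite (gt_eqF x0) implybT.
  rewrite -[x ^+ 5]powR_mulrn ?ltW// -(powRD x5); congr (x `^ _); ring.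
by ring.
Qed.

Let dprim_derivable lam (x : R) : 0 < x -> derivable (dprim lam) x 1.
Proof.
move=> x0; have [dE _] := expRN6_is_derive x.
have [d1 _] := is_derive1_powR (2 * lam + 1) x0.
have [d2 _] := is_derive1_powR (2 * (lam + 3) + 1) x0.
have H1 : derivable ((2 * lam + 2) *: ((fun x : R => x `^ (2 * lam + 1)) *
    (fun x => expR (- x ^+ 6)))) x 1 by apply: derivableZ; refine (derivableM d1 dE).
have H2 : derivable (6 *: ((fun x : R => x `^ (2 * (lam + 3) + 1)) *
    (fun x => expR (- x ^+ 6)))) x 1 by apply: derivableZ; refine (derivableM d2 dE).
have H := derivableB H1 H2; refine H.
Qed.

(** The derivative of x^(2 lam + 2) exp(-x^6) is integrated over the half-line; the boundary terms
    vanish. Through [Gamma_freud] this reads s Gamma(s) = Gamma(s + 1) with s = (lam + 1) / 3. *)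
Lemma mu0_recurrence lam : -1 < lam -> 3 * mu0 (lam + 3) 0 = (lam + 1) * mu0 lam 0.
Proof.
move=> l1; have l3 : -1 < lam + 3 by lra.
rewrite !mu0_half//; apply/eqP; rewrite -subr_eq0; apply/eqP.
have c1 := @cvg_Rintegral_freud lam 0 l1.
have c3 := @cvg_Rintegral_freud (lam + 3) 0 l3.
pose I1 := \int[leb]_(x in `]0, +oo[) freud_weight lam 0 x.
pose I3 := \int[leb]_(x in `]0, +oo[) freud_weight (lam + 3) 0 x.
rewrite -/I1 -/I3.
have c : (2 * lam + 2) * \int[leb]_(x in `[n.+1%:R^-1, n.+1%:R]) freud_weight lam 0 x
    - 6 * \int[leb]_(x in `[n.+1%:R^-1, n.+1%:R]) freud_weight (lam + 3) 0 x
    @[n --> \oo] --> (2 * lam + 2) * I1 - 6 * I3.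
  by apply: cvgB; apply: cvgMr.
have c' : (2 * lam + 2) * \int[leb]_(x in `[n.+1%:R^-1, n.+1%:R]) freud_weight lam 0 x
    - 6 * \int[leb]_(x in `[n.+1%:R^-1, n.+1%:R]) freud_weight (lam + 3) 0 x
    @[n --> \oo] --> (0 - 0 : R).
  apply: cvg_trans (cvgB (@cvg_primy lam) (cvg_prim0 l1)).
  apply: near_eq_cvg; near=> n.
  have n0 : (0 : R) < n.+1%:R^-1 by rewrite invr_gt0.
  have n1 : n.+1%:R^-1 < (n.+1%:R : R).
    have n2 : (1 : R) < n.+1%:R by rewrite ltr1n ltnS; near: n; exact: nbhs_infty_gt.
    by apply: (lt_trans _ n2); rewrite invf_lt1.
  have FTC : (\int[leb]_(x in `[(n.+1%:R^-1)%R, (n.+1%:R)%R]) (dprim lam x)%:E =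
      (prim lam n.+1%:R - prim lam n.+1%:R^-1)%:E)%E.
    refine (@is_derive_integral_itv R (dprim lam) (prim lam) _ _ n1 _ _).
      by move=> x /andP[nx _]; apply: prim_is_derive; exact: lt_le_trans nx.
    move=> x /andP[nx _].
    by have H := @dprim_derivable lam x (lt_le_trans n0 nx); refine H.
  have iS l : -1 < l -> leb.-integrable (`[n.+1%:R^-1, n.+1%:R]%classic : set R)
      (EFin \o freud_weight l 0).
    by move=> ll; exact: integrableS (integrable_freud_weight 0 ll).
  have iZ l k : -1 < l -> leb.-integrable (`[n.+1%:R^-1, n.+1%:R]%classic : set R)
      (EFin \o (fun x => k * freud_weight l 0 x)).
    move=> ll; have H : leb.-integrable (`[n.+1%:R^-1, n.+1%:R]%classic : set R)
        (fun x => (k%:E * (freud_weight l 0 x)%:E)%E).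
      by apply: integrableZl => //; exact: iS.
    exact: H.
  rewrite -!RintegralZl ?iS// -RintegralB ?iZ//.
  transitivity (prim lam n.+1%:R - prim lam n.+1%:R^-1); first by [].
  have := congr1 fine FTC; rewrite [RHS]/= => <-.
  apply: eq_Rintegral => x; rewrite inE /= in_itv /= => /andP[nx _].
  have x0 := lt_le_trans n0 nx.
  by rewrite /dprim /freud_weight !mul0r !addr0 (gtr0_norm x0).
have := cvg_unique _ c c'; rewrite subr0 => /(_ (@Rhausdorff R)) E.
rewrite (_ : _ - _ = - ((2 * lam + 2) * I1 - 6 * I3)); last by ring.
by rewrite E oppr0.
Unshelve. all: by end_near. Qed.

End GammaMoments.

(** * The hypergeometric expansion *)

Section Hypergeometric.
Variable R : realType.
Implicit Types lam t x : R.
Notation leb := (@lebesgue_measure R).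

Lemma pochhammerS (a : R) k : pochhammer a k.+1 = pochhammer a k * (a + k%:R).
Proof. by rewrite /pochhammer big_nat_recr. Qed.

Lemma pochhammer_gt0 (a : R) k : 0 < a -> 0 < pochhammer a k.
Proof.
move=> a0; apply: prodr_gt0 => i _; exact: ltr_wpDr.
Qed.

Definition hyp1F2_coeff (a b1 b2 z : R) (k : nat) : R :=
  pochhammer a k / (pochhammer b1 k * pochhammer b2 k) * (z ^+ k / k`!%:R).

(** The factor (a + k) / ((b1 + k) (b2 + k)) gained at each step is at most C = (1 + a / b1) / b2,
    so the series is dominated by that of exp(C |z|). *)
Lemma is_cvg_hyp1F2 (a b1 b2 z : R) : 0 < a -> 0 < b1 -> 0 < b2 ->
  cvgn (series (hyp1F2_coeff a b1 b2 z)).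
Proof.
move=> a0 b10 b20; apply: normed_cvg.
pose C := (1 + a / b1) / b2.
have q0 k : 0 <= pochhammer a k / (pochhammer b1 k * pochhammer b2 k).
  by rewrite divr_ge0 ?mulr_ge0// ltW// pochhammer_gt0.
have C0 : 0 <= C by rewrite divr_ge0 ?addr_ge0 ?divr_ge0// ltW.
have qC k : pochhammer a k / (pochhammer b1 k * pochhammer b2 k) <= C ^+ k.
  elim: k => [|k IH].
    by rewrite /pochhammer !big_nil expr0 mulr1 divr1.
  have B1 : 0 < b1 + k%:R by rewrite ltr_wpDr.
  have B2 : 0 < b2 + k%:R by rewrite ltr_wpDr.
  have p1 := pochhammer_gt0 k b10; have p2 := pochhammer_gt0 k b20.
  rewrite !pochhammerS exprSr.
  have -> : pochhammer a k * (a + k%:R) /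
      (pochhammer b1 k * (b1 + k%:R) * (pochhammer b2 k * (b2 + k%:R))) =
      pochhammer a k / (pochhammer b1 k * pochhammer b2 k) *
      ((a + k%:R) / (b1 + k%:R) / (b2 + k%:R)).
    by field; rewrite !gt_eqF.
  apply: ler_pM => //.
    by rewrite !divr_ge0 ?addr_ge0 ?(ltW a0) ?(ltW b10) ?(ltW b20).
  rewrite /C; apply: ler_pM.
  - by rewrite divr_ge0 ?addr_ge0 ?(ltW a0) ?(ltW b10).
  - by rewrite invr_ge0 ltW.
  - rewrite ler_pdivrMr// mulrDl mul1r [leRHS]addrC -[leLHS]addr0 -addrA.
    have : a <= a / b1 * (b1 + k%:R).
      rewrite mulrDr divfK ?gt_eqF// lerDl mulr_ge0 ?divr_ge0 ?(ltW a0) ?(ltW b10)//.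
    move: b10; lra.
  - by rewrite lef_pV2 ?posrE// lerDl.
apply: (@series_le_cvg _ _ (exp_coeff (C * `|z|))) => [k|k|k|].
- exact: normr_ge0.
- by rewrite exp_coeff_ge0// mulr_ge0.
- rewrite /= /hyp1F2_coeff /exp_coeff /= normrM (ger0_norm (q0 k)) normrM normfV normrX.
  rewrite (ger0_norm (ler0n R k`!)) exprMn -[leRHS]mulrA.
  by rewrite ler_wpM2r// divr_ge0// exprn_ge0.
- exact: is_cvg_series_exp_coeff.
Qed.

Lemma mu0_shift lam j : -1 < lam ->
  mu0 (lam + (3 * j)%:R) 0 = pochhammer ((lam + 1) / 3) j * mu0 lam 0.
Proof.
move=> l1; elim: j => [|j IH].
  by rewrite muln0 addr0 /pochhammer big_nil mul1r.
have lj : -1 < lam + (3 * j)%:R by rewrite ltr_wpDr.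
have := mu0_recurrence lj; rewrite IH pochhammerS mulnS natrD => E.
rewrite (_ : lam + (3%:R + (3 * j)%:R) = lam + (3 * j)%:R + 3); last by ring.
apply: (@mulfI _ 3); first by rewrite pnatr_eq0.
by rewrite E natrM; field.
Qed.

(** Dominated convergence: the partial sums of exp(t x^2) are at most exp(|t| x^2), so the weight at
    |t| dominates. The partial sums are polynomials in x, hence their integrals are values of the
    moment functional. *)
Lemma cvg_series_mu0 lam t : -1 < lam ->
  series (fun k => t ^+ k / k`!%:R * mu0 (lam + k%:R) 0) n @[n --> \oo] -->
  mu0 lam t.
Proof.
move=> l1.
pose p n : {poly R} := \sum_(0 <= k < n) (t ^+ k / k`!%:R) *: 'X^(k.*2).
have pE n x : (p n).[x] = series (exp_coeff (t * x ^+ 2)) n.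
  rewrite /p horner_sum; apply: eq_bigr => k _.
  by rewrite hornerZ hornerXn /exp_coeff /= exprMn -exprM mul2n mulrAC.
have intp n : \int[leb]_x ((p n).[x] * freud_weight lam 0 x) =
    series (fun k => t ^+ k / k`!%:R * mu0 (lam + k%:R) 0) n.
  rewrite (integrable_poly_freud 0 (p n) l1).2 /p linear_sum /=.
  apply: eq_bigr => k _.
  by rewrite linearZ /= momfXn /moment odd_double doubleK.
have fwE s x : freud_weight lam s x = expR (s * x ^+ 2) * freud_weight lam 0 x.
  by rewrite /freud_weight mul0r addr0 expRD; ring.
rewrite (_ : (fun n => _) = fun n => \int[leb]_x ((p n).[x] * freud_weight lam 0 x));
  last by apply/funext => n; rewrite intp.
apply: fine_cvg; rewrite fineK; last first.
  by apply: integrable_fin_num => //; exact: integrable_freud_weight.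
apply: (@dominated_cvg _ _ _ leb setT measurableT
  (fun n x => ((p n).[x] * freud_weight lam 0 x)%:E) _
  (EFin \o freud_weight lam `|t|)) => //.
- move=> n; have [H _] := integrable_poly_freud 0 (p n) l1.
  by case/integrableP : H.
- move=> x _; apply: cvg_EFin; first exact: nearW.
  rewrite /comp /=; under eq_fun do rewrite pE.
  rewrite fwE; apply: cvgMl; exact: is_cvg_series_exp_coeff.
- exact: integrable_freud_weight.
- move=> n x _; rewrite /= lee_fin normrM (ger0_norm (freud_weight_ge0 _ _ _)).
  rewrite [leRHS]fwE ler_wpM2r ?freud_weight_ge0// pE.
  apply: le_trans (ler_norm_sum _ _ _) _.
  rewrite (_ : \sum_(0 <= i < n) _ = series (exp_coeff (`|t| * x ^+ 2)) n); last first.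
    apply: eq_bigr => k _; rewrite /exp_coeff /= normrM normfV normrX normrM.
    by rewrite (ger0_norm (ler0n _ _)) (ger0_norm (sqr_ge0 x)).
  apply: nondecreasing_cvgn_le; last exact: is_cvg_series_exp_coeff.
  apply: nondecreasing_series => k _ _.
  by rewrite exp_coeff_ge0// mulr_ge0// sqr_ge0.
Qed.

(** Sorting the factors of (3j)! modulo 3 gives 27^j times three Pochhammer symbols, one of which is
    j!. The power 27^j cancels against t^(3j) = 27^j ((t/3)^3)^j, and the other two symbols supply
    the lower parameters. *)
Lemma fact3 j : ((3 * j)`!%:R : R) =
  27 ^+ j * j`!%:R * (pochhammer (1 / 3) j * pochhammer (2 / 3) j).
Proof.
elim: j => [|j IH]; first by rewrite /pochhammer !big_nil !mulr1.
rewrite mulnS !pochhammerS add3n !factS !natrM IH exprS.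
by rewrite -!natr1 natrM; field.
Qed.

Lemma fact3D1 j : ((3 * j + 1)`!%:R : R) =
  27 ^+ j * j`!%:R * (pochhammer (2 / 3) j * pochhammer (4 / 3) j).
Proof.
elim: j => [|j IH]; first by rewrite /pochhammer !big_nil !mulr1.
rewrite mulnS -addnA !pochhammerS add3n !factS !natrM IH exprS.
by rewrite -!natr1 natrD natrM; field.
Qed.

(** The prefactor is 2!, the value at j = 0; it turns the common 1/3 into the 1/6 of the t^2
    term. *)
Lemma fact3D2 j : ((3 * j + 2)`!%:R : R) =
  2 * (27 ^+ j * j`!%:R * (pochhammer (4 / 3) j * pochhammer (5 / 3) j)).
Proof.
elim: j => [|j IH]; first by rewrite /pochhammer !big_nil !mulr1.
rewrite mulnS -addnA !pochhammerS add3n !factS !natrM IH exprS.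
by rewrite -!natr1 natrD natrM; field.
Qed.

Lemma series_mul3 (u : nat -> R) n :
  series u (3 * n)%N = series (fun j => u (3 * j)%N) n +
    series (fun j => u (3 * j + 1)%N) n + series (fun j => u (3 * j + 2)%N) n.
Proof.
elim: n => [|n IH]; first by rewrite muln0 /series /= !big_geq// !addr0.
have serS (v : nat -> R) m : series v m.+1 = series v m + v m.
  by rewrite /series /= big_nat_recr.
rewrite mulnS add3n !serS IH addn1 addn2; ring.
Qed.

Lemma mu0_hypergeometric lam t : -1 < lam ->
  mu0 lam t =
    1 / 3 * Gamma (lam / 3 + 1 / 3)
      * hyp1F2 (lam / 3 + 1 / 3) (1 / 3) (2 / 3) ((t / 3) ^+ 3)
    + 1 / 3 * t * Gamma (lam / 3 + 2 / 3)
      * hyp1F2 (lam / 3 + 2 / 3) (2 / 3) (4 / 3) ((t / 3) ^+ 3)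
    + 1 / 6 * t ^+ 2 * Gamma (lam / 3 + 1)
      * hyp1F2 (lam / 3 + 1) (4 / 3) (5 / 3) ((t / 3) ^+ 3).
Proof.
move=> l1; pose u k := t ^+ k / k`!%:R * mu0 (lam + k%:R) 0.
set z := (t / 3) ^+ 3.
(* One formula for all residues: [mu0_shift] is applied at lam + r, which makes (lam + r + 1) / 3
   the upper parameter. *)
have uE r j : u (3 * j + r)%N =
    t ^+ r * (27 ^+ j * z ^+ j) / (3 * j + r)`!%:R *
    (pochhammer ((lam + r%:R + 1) / 3) j * (Gamma ((lam + r%:R + 1) / 3) / 3)).
  have lr : -1 < lam + r%:R by rewrite ltr_wpDr.
  rewrite Gamma_freud// (_ : 3 * _ / 3 = mu0 (lam + r%:R) 0); last by field.
  rewrite -mu0_shift// /u natrD addrA addrAC -exprMn; congr (_ / _ * _).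
  rewrite exprD mulrC exprM /z; congr (_ * _ ^+ _).
  by field.
have f0 m : (m`!%:R : R) != 0 by rewrite pnatr_eq0 -lt0n fact_gt0.
have p0 (a : R) j : 0 < a -> pochhammer a j != 0.
  by move=> a0; rewrite gt_eqF// pochhammer_gt0.
have E0 j : u (3 * j)%N = 1 / 3 * Gamma (lam / 3 + 1 / 3) *
    hyp1F2_coeff (lam / 3 + 1 / 3) (1 / 3) (2 / 3) z j.
  rewrite -[(3 * j)%N]addn0 uE addn0 fact3 /hyp1F2_coeff addr0.
  rewrite (_ : (lam + 1) / 3 = lam / 3 + 1 / 3); last by field.
  by field; rewrite f0 !p0// expf_neq0.
have E1 j : u (3 * j + 1)%N = 1 / 3 * t * Gamma (lam / 3 + 2 / 3) *
    hyp1F2_coeff (lam / 3 + 2 / 3) (2 / 3) (4 / 3) z j.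
  rewrite uE fact3D1 /hyp1F2_coeff.
  rewrite (_ : (lam + 1%:R + 1) / 3 = lam / 3 + 2 / 3); last by field.
  by field; rewrite f0 !p0// expf_neq0.
have E2 j : u (3 * j + 2)%N = 1 / 6 * t ^+ 2 * Gamma (lam / 3 + 1) *
    hyp1F2_coeff (lam / 3 + 1) (4 / 3) (5 / 3) z j.
  rewrite uE fact3D2 /hyp1F2_coeff.
  rewrite (_ : (lam + 2%:R + 1) / 3 = lam / 3 + 1); last by field.
  by field; rewrite f0 !p0// expf_neq0.
(* Partial sums of length 3n split evenly into the three residue classes, and the convergence of the
   full series passes to this subsequence. *)
have c3 : series u (3 * n)%N @[n --> \oo] --> mu0 lam t.
  apply: (@cvg_comp _ _ _ (fun n => (3 * n)%N) (series u) \oo \oo).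
    move=> A [N _ NA]; exists N => // n /= Nn; apply: NA => /=.
    by rewrite (leq_trans Nn)// leq_pmull.
  exact: cvg_series_mu0.
have serE : (fun n => series u (3 * n)%N) = (fun n =>
    1 / 3 * Gamma (lam / 3 + 1 / 3) *
      series (hyp1F2_coeff (lam / 3 + 1 / 3) (1 / 3) (2 / 3) z) n +
    1 / 3 * t * Gamma (lam / 3 + 2 / 3) *
      series (hyp1F2_coeff (lam / 3 + 2 / 3) (2 / 3) (4 / 3) z) n +
    1 / 6 * t ^+ 2 * Gamma (lam / 3 + 1) *
      series (hyp1F2_coeff (lam / 3 + 1) (4 / 3) (5 / 3) z) n).
  apply/funext => n; rewrite series_mul3.
  congr (_ + _ + _); rewrite [in RHS]/series /= mulr_sumr.
  - by apply: eq_bigr => j _; rewrite E0.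
  - by apply: eq_bigr => j _; rewrite E1.
  - by apply: eq_bigr => j _; rewrite E2.
have c4 : series u (3 * n)%N @[n --> \oo] -->
    1 / 3 * Gamma (lam / 3 + 1 / 3) *
      hyp1F2 (lam / 3 + 1 / 3) (1 / 3) (2 / 3) z +
    1 / 3 * t * Gamma (lam / 3 + 2 / 3) *
      hyp1F2 (lam / 3 + 2 / 3) (2 / 3) (4 / 3) z +
    1 / 6 * t ^+ 2 * Gamma (lam / 3 + 1) *
      hyp1F2 (lam / 3 + 1) (4 / 3) (5 / 3) z.
  rewrite serE; have l3 : -1 < 3 * (lam / 3) by rewrite mulrCA mulfV ?mulr1.
  have h a b1 b2 : 0 < a -> 0 < b1 -> 0 < b2 ->
      series (hyp1F2_coeff a b1 b2 z) n @[n --> \oo] --> hyp1F2 a b1 b2 z.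
    by move=> a0 b10 b20; exact: (@is_cvg_hyp1F2 a b1 b2 z a0 b10 b20).
  by apply: cvgD; [apply: cvgD|]; apply: cvgMr; apply: h; lra.
exact: (cvg_unique (@Rhausdorff R) c3 c4).
Qed.

End Hypergeometric.

(** * Conclusion *)

Lemma moment_is_derive (R : realType) (lam t : R) (i : nat) : -1 < lam ->
  is_derive t 1 (fun s => moment lam s i) (moment lam t i.+2).
Proof.
move=> l1; rewrite /moment /= negbK; case: ifP => _; first exact: is_derive_cst.
have lk : -1 < lam + i./2%:R by rewrite ltr_wpDr.
by rewrite -natr1 addrA; have H := mu0_is_derive t lk; refine H.
Qed.

(** Entry (j, k) of the Wronskian is the (j+k)-th derivative, that is the moment of x^(2(e+j+k));
    this is the product of X^(e+2j) and X^(e+2k), so raising lam by 1 passes from even to odd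
    monomials. *)
Lemma freudA_gram (R : realType) (e : bool) (n : nat) (lam t : R) : -1 < lam ->
  freudA n (lam + e%:R) t = gram (moment lam) e n t.
Proof.
move=> l1; have M_odd s i : odd i -> moment lam s i = 0 by rewrite /moment => ->.
have L_odd i : odd i -> momf (moment lam t) 'X^i = 0.
  by move=> oi; rewrite momfXn M_odd.
have L_pos (p : {poly R}) : p != 0 -> 0 < momf (moment lam t) (p * p).
  exact: momf_freud_gt0.
rewrite /gram -(gram_det L_odd L_pos) /freudA /wronskian; congr (\det _).
apply/matrixP => j k; rewrite !mxE -exprD.
have le : -1 < lam + e%:R by rewrite ltr_wpDr.
have lek : -1 < lam + e%:R + k%:R by rewrite ltr_wpDr.
have -> : derive1n k (mu0 (lam + e%:R)) = mu0 (lam + e%:R + k%:R).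
  by apply/funext => s; rewrite mu0_derive1n.
rewrite mu0_derive1n// -/(momf _) [RHS]momfXn /moment.
have -> : odd (e + j.*2 + (e + k.*2)) = false by case: (e); lia.
congr (mu0 _ t); rewrite -!addrA -!natrD; congr (_ + _%:R).
by case: (e); lia.
Qed.

Unset Implicit Arguments.

Theorem lemma3p5 (R : realType) (lam t : R) (hlam : -1 < lam) :
  (* the moment integral converges and has the stated closed form *)
  lebesgue_measure.-integrable setT (EFin \o freud_weight lam t) /\
  mu0 lam t =
    1 / 3 * Gamma (lam / 3 + 1 / 3)
      * hyp1F2 (lam / 3 + 1 / 3) (1 / 3) (2 / 3) ((t / 3) ^+ 3)
    + 1 / 3 * t * Gamma (lam / 3 + 2 / 3)
      * hyp1F2 (lam / 3 + 2 / 3) (2 / 3) (4 / 3) ((t / 3) ^+ 3)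
    + 1 / 6 * t ^+ 2 * Gamma (lam / 3 + 1)
      * hyp1F2 (lam / 3 + 1) (4 / 3) (5 / 3) ((t / 3) ^+ 3) /\
  (* the Wronskians, quotients and logarithms below are well defined *)
  (forall k : nat, derivable (derive1n k (mu0 lam)) t 1) /\
  (forall n : nat, 0 < freudA n lam t) /\
  (* the monic orthogonal polynomials and their recurrence *)
  (exists P : nat -> {poly R}, monic_orthogonal (freud_weight lam t) P) /\
  exists beta : nat -> R,
    (forall P : nat -> {poly R}, monic_orthogonal (freud_weight lam t) P ->
      P 0%N = 1 /\
      forall n : nat,
        P n.+1 = 'X * P n - beta n *: (if n is m.+1 then P m else 0)) /\
    forall n : nat,
      beta n.*2 =
        freudA (n%:Z + 1) lam t * freudA (n%:Z - 1) (lam + 1) t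
          / (freudA n lam t * freudA n (lam + 1) t) /\
      is_derive t 1
        (fun s : R => ln (freudA n (lam + 1) s / freudA n lam s))
        (beta n.*2) /\
      beta n.*2.+1 =
        freudA n lam t * freudA (n%:Z + 1) (lam + 1) t
          / (freudA (n%:Z + 1) lam t * freudA n (lam + 1) t) /\
      is_derive t 1
        (fun s : R => ln (freudA (n%:Z + 1) lam s / freudA n (lam + 1) s))
        (beta n.*2.+1).
Proof.
have M_derive (s : R) i := @moment_is_derive R lam s i hlam.
have M_odd s i : odd i -> moment lam s i = 0 by rewrite /moment => ->.
have M_pos s (p : {poly R}) : p != 0 -> 0 < momf (moment lam s) (p * p).
  exact: momf_freud_gt0.
have L_odd i : odd i -> momf (moment lam t) 'X^i = 0.
  by move=> oi; rewrite momfXn M_odd.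
have A0 (n : nat) s : freudA n lam s = gram (moment lam) false n s.
  by rewrite -freudA_gram// addr0.
have A1 (n : nat) s : freudA n (lam + 1) s = gram (moment lam) true n s.
  by rewrite -freudA_gram.
have g_gt0 := gram_gt0 M_pos.
have S1 (n : nat) : n%:Z + 1 = n.+1%:Z by rewrite -PoszD addn1.
have orthoE (p q : {poly R}) :
    (\int[lebesgue_measure]_x (p.[x] * q.[x] * freud_weight lam t x)%:E =
     (momf (moment lam t) (p * q))%:E)%E.
  rewrite -integral_poly_freud//; apply: eq_integral => x _.
  by rewrite hornerM.
split; first exact: integrable_freud_weight.
split; first exact: mu0_hypergeometric.
split.
  move=> k; have lk : -1 < lam + k%:R by rewrite ltr_wpDr.
  have -> : derive1n k (mu0 lam) = mu0 (lam + k%:R).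
    by apply/funext => s; rewrite mu0_derive1n.
  by have [H _] := mu0_is_derive t lk; refine H.
split; first by move=> n; rewrite A0.
split.
  exists (orthp (momf (moment lam t))); split; first exact: orthp_monic_size.
  move=> m n mn; rewrite orthoE orthp_ortho_neq//.
  exact: M_pos.
(* The coefficients are chosen before the family P; uniqueness transfers the recurrence of [orthp]
   to every orthogonal family. *)
exists (orthb (momf (moment lam t))); split.
  move=> P [Pm PO].
  have PE n : P n = orthp (momf (moment lam t)) n.
    apply: monic_orthogonal_unique => //; first exact: M_pos.
    by move=> m k mk; have := PO m k mk; rewrite orthoE => -[].
  by split=> [|n]; rewrite !PE// orthpS; case: n => // n; rewrite !PE.
move=> n; rewrite !S1.
split; [|split; [|split]].
(* For n = 0 the factor of index -1 is 0 by definition, in agreement with b_0 = 0. *)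
- case: n => [|n]; first by rewrite mulr0 mul0r.
  rewrite orthb_even_gram// !A0 (_ : n.+1%:Z - 1 = n) ?A1//.
  by rewrite -addn1 PoszD addrK.
- rewrite (_ : (fun s : R => _) =
    fun s => ln (gram (moment lam) true n s / gram (moment lam) false n s)).
    have H := ln_gram_is_derive M_derive M_odd M_pos n t; refine H.
  by apply/funext => s; rewrite A0 A1.
- by rewrite orthb_odd_gram// !A0 !A1.
- rewrite (_ : (fun s : R => _) =
    fun s => ln (gram (moment lam) false n.+1 s / gram (moment lam) true n s)).
    have H := ln_gramS_is_derive M_derive M_odd M_pos n t; refine H.
  by apply/funext => s; rewrite A0 A1.
Qed.
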